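(* Let $I_0=[t_0,t_0+L]$ ($L>0$), $r\ge 0$, $I_-=[t_0-r,t_0]$, $I=I_-\cup I_0$. Let $f:I\times\mathbb{R}^2\to\mathbb{R}$ and $\tau:I_0\times\mathcal{C}(I)\to I$ be Carathéodory functions, $\Lambda:\mathcal{C}(I)\to\mathbb{R}$ a (possibly nonlinear) operator and $k\in\mathcal{C}(I_-)$, and consider the problem $$(P)\qquad x'(t)=f(t,x(t),x(\tau(t,x)))\ \text{ for a.a. } t\in I_0,\qquad x(t)=\Lambda(x)+k(t)\ \text{ for all } t\in I_-.$$ Assume that: 1. There exist $\alpha,\beta\in\mathcal{C}(I)$, with $\alpha\le\beta$ on $I$, which are a lower and an upper solution for problem $(P)$ (in the sense defined in the context). Let $E(t)$, $t\in I_0$, be the corresponding intervals defined in the context. 2. (a) For all $x,y\in[\min_{t\in I}\alpha(t),\max_{t\in I}\beta(t)]$ the function $f(\cdot,x,y)$ is measurable, and for a.a. $t\in I_0$, all $x\in[\alpha(t),\beta(t)]$ and all $y\in E(t)$ the functions $f(t,\cdot,y)$ and $f(t,x,\cdot)$ are continuous. (b) For all $\gamma\in[\alpha,\beta]=\{\xi\in\mathcal{C}(I):\alpha\le\xi\le\beta\text{ on }I\}$ the function $\tau(\cdot,\gamma)$ is measurable, and for a.a. $t\in I_0$ the operator $\tau(t,\cdot)$ is continuous in $\mathcal{C}(I)$ (with the topology of uniform convergence). (c) The operator $\Lambda:\mathcal{C}(I)\to\mathbb{R}$ is continuous. 3. There exists $\psi\in L^1(I_0)$ such that for a.a. $t\in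 I_0$, all $x\in[\alpha(t),\beta(t)]$ and all $y\in E(t)$ we have $|f(t,x,y)|\le\psi(t)$. Then problem $(P)$ has maximal and minimal solutions in $[\alpha,\beta]$.
   Context: $\mathcal{C}(J)$ is the set of real continuous functions on the interval $J$; $AC(I_0)$ is the set of absolutely continuous functions on $I_0$; ''a.a.'' means almost all (Lebesgue measure). Carathéodory means measurable in $t$ for each fixed value of the remaining variables, and, for a.a. $t$, continuous in the remaining variables (jointly in $(x,y)\in\mathbb{R}^2$ for $f$; on $\mathcal{C}(I)$ with the topology of uniform convergence for $\tau$). A solution of $(P)$ is a function $x\in\mathcal{C}(I)$ such that $x_{|I_0}\in AC(I_0)$ and $x$ satisfies both relations in $(P)$. Order: for $\gamma_1,\gamma_2\in\mathcal{C}(I)$, $\gamma_1\le\gamma_2$ iff $\gamma_1(t)\le\gamma_2(t)$ for all $t\in I$. For $Y\subset\mathcal{C}(I)$, a solution $x_*\in Y$ is a minimal (respectively, maximal) solution in $Y$ if, whenever $x\in Y$ is a solution with $x\le x_*$ (respectively, $x\ge x_*$), then $x=x_*$. Lower and upper solutions: for $t\in I_0$ put $\tau_*(t)=\inf_{\gamma\in\mathcal{C}(I)}\tau(t,\gamma)\in I$ and $\tau^*(t)=\sup_{\gamma\in\mathcal{C}(I)}\tau(t,\gamma)\in I$. Functions $\alpha,\beta\in\mathcal{C}(I)$ with $\alpha\le\beta$ on $I$ are a lower and an upper solution for $(P)$ if $\alpha_{|I_0},\beta_{|I_0}\in AC(I_0)$ and $$\alpha'(t)\le\min_{\xi\in E(t)}f(t,\alpha(t),\xi)\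 \text{ for a.a. }t\in I_0,\qquad \alpha\le\inf_{\gamma\in[\alpha,\beta]}\Lambda(\gamma)+k\ \text{ on }I_-,$$ $$\beta'(t)\ge\max_{\xi\in E(t)}f(t,\beta(t),\xi)\ \text{ for a.a. }t\in I_0,\qquad \beta\ge\sup_{\gamma\in[\alpha,\beta]}\Lambda(\gamma)+k\ \text{ on }I_-,$$ where $$E(t)=\Big[\min_{s\in[\tau_*(t),\tau^*(t)]}\alpha(s),\ \max_{s\in[\tau_*(t),\tau^*(t)]}\beta(s)\Big]\quad(t\in I_0),$$ and $[\alpha,\beta]=\{\gamma\in\mathcal{C}(I):\alpha\le\gamma\le\beta\text{ on }I\}$. (This implicitly requires $\Lambda$ to be bounded on $[\alpha,\beta]$.) *)

(* Defs.v *)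
From mathcomp Require Import all_boot all_order all_algebra.
From mathcomp Require Import all_classical all_reals all_analysis.

Set Implicit Arguments.
Unset Strict Implicit.
Unset Printing Implicit Defensive.

Import Order.TTheory GRing.Theory Num.Theory.
Import numFieldNormedType.Exports.

Local Open Scope classical_set_scope.
Local Open Scope ring_scope.

Section FunctionSpaces.
Context {R : realType}.
Implicit Types (J D : set R) (x : R -> R).

(* C(J). A function on J is represented by its extension by 0 to R, so that
   every element of C(J) has exactly one representative and equality of
   representatives is equality on J. *)
Definition Cspace J : set (R -> R) :=
  [set x | {within J, continuous x} /\ forall t, ~ J t -> x t = 0].

Definition le_on J (x y : R -> R) : Prop := forall t, J t -> x t <= y t.

Definition order_interval J (alpha beta : R -> R) : set (R -> R) :=
  [set gamma | [/\ Cspace J gamma, le_on J alpha gamma & le_on J gamma beta]].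

(* Continuity of Phi : C(J) -> R for the topology of uniform convergence
   on J. *)
Definition continuous_on_Cspace J (Phi : (R -> R) -> R) : Prop :=
  {within (Cspace J : set {uniform` J -> R}),
    continuous (Phi : {uniform` J -> R} -> R)}.

Definition absolutely_continuous_on J x : Prop :=
  forall e : R, 0 < e -> exists2 d : R, 0 < d &
    forall (n : nat) (u v : 'I_n -> R),
      (forall i, u i <= v i /\ `[u i, v i] `<=` J) ->
      trivIset [set: 'I_n] (fun i => [set` `]u i, v i[]) ->
      \sum_(i < n) (v i - u i) < d ->
      \sum_(i < n) `|x (v i) - x (u i)| < e.

(* The library's measurable_fun on R refers to the Borel sigma-algebra; here
   the domain carries the (complete) Lebesgue sigma-algebra. *)
Definition Lebesgue_measurable_fun D (g : R -> R) : Prop :=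
  @measurable_fun _ _ (caratheodory_type (@wlength R idfun)^*%mu) R D g.

Definition Lebesgue_integrable D (g : R -> R) : Prop :=
  (@completed_lebesgue_measure R).-integrable D (EFin \o g).

(* lebesgue_measure and its completion have the same negligible sets. *)
Definition ae_on D (Q : R -> Prop) : Prop :=
  {ae (@lebesgue_measure R), forall t, D t -> Q t}.

Definition caratheodory_scalar D (f : R -> R -> R -> R) : Prop :=
  (forall x y : R, Lebesgue_measurable_fun D (fun t => f t x y)) /\
  ae_on D (fun t => continuous (fun p : R * R => f t p.1 p.2)).

Definition caratheodory_operator D J (tau : R -> (R -> R) -> R) : Prop :=
  (forall gamma, Cspace J gamma ->
     Lebesgue_measurable_fun D (fun t => tau t gamma)) /\
  ae_on D (fun t => continuous_on_Cspace J (tau t)).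

End FunctionSpaces.

Section Problem.
Context {R : realType}.
Variables (t0 L r : R).

Definition Izero : set R := `[t0, t0 + L].
Definition Iminus : set R := `[t0 - r, t0].
Definition Itotal : set R := Iminus `|` Izero.

Variables (f : R -> R -> R -> R) (tau : R -> (R -> R) -> R).
Variables (Lambda : (R -> R) -> R) (k : R -> R).

(* "derivable" is part of reading an equation or inequality for x' almost
   everywhere; derive1 alone is a total operator. *)
Definition solution (x : R -> R) : Prop :=
  [/\ Cspace Itotal x,
      absolutely_continuous_on Izero x,
      ae_on Izero (fun t =>
        derivable x t 1 /\ derive1 x t = f t (x t) (x (tau t x)))
    & forall t, Iminus t -> x t = Lambda x + k t].

Definition minimal_solution (Y : set (R -> R)) (xs : R -> R) : Prop :=
  [/\ Y xs, solution xs
    & forall x, Y x -> solution x -> le_on Itotal x xs -> x = xs].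

Definition maximal_solution (Y : set (R -> R)) (xs : R -> R) : Prop :=
  [/\ Y xs, solution xs
    & forall x, Y x -> solution x -> le_on Itotal xs x -> x = xs].

Definition tau_inf (t : R) : R := inf [set tau t gamma | gamma in Cspace Itotal].
Definition tau_sup (t : R) : R := sup [set tau t gamma | gamma in Cspace Itotal].

(* The interval E(t); the extrema are attained since alpha and beta are
   continuous on the compact set [tau_inf t, tau_sup t]. *)
Definition Eset (alpha beta : R -> R) (t : R) : set R :=
  `[inf (alpha @` `[tau_inf t, tau_sup t]),
    sup (beta @` `[tau_inf t, tau_sup t])].

(* Extended-real infima and suprema: the conditions on Iminus then force
   Lambda to be bounded on [alpha, beta]. For almost all t the infimum and
   supremum over Eset are attained when f is a Caratheodory function. *)
Definition lower_upper_solutions (alpha beta : R -> R) : Prop :=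
  [/\ [/\ Cspace Itotal alpha, Cspace Itotal beta & le_on Itotal alpha beta],
      absolutely_continuous_on Izero alpha,
      absolutely_continuous_on Izero beta,
      ae_on Izero (fun t => derivable alpha t 1 /\
        ((derive1 alpha t)%:E <=
           ereal_inf [set (f t (alpha t) xi)%:E | xi in Eset alpha beta t])%E) /\
      (forall t, Iminus t ->
        ((alpha t)%:E <=
           ereal_inf [set (Lambda gamma)%:E
                     | gamma in order_interval Itotal alpha beta] +
           (k t)%:E)%E)
    & ae_on Izero (fun t => derivable beta t 1 /\
        (ereal_sup [set (f t (beta t) xi)%:E | xi in Eset alpha beta t] <=
           (derive1 beta t)%:E)%E) /\
      (forall t, Iminus t ->
        (ereal_sup [set (Lambda gamma)%:E
                   | gamma in order_interval Itotal alpha beta] +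
           (k t)%:E <= (beta t)%:E)%E)].

End Problem.

(* Main.v *)
Require Import Defs.
From mathcomp Require Import all_boot all_order all_algebra.
From mathcomp Require Import all_classical all_reals all_analysis.
From mathcomp Require Import measurable_realfun.
From mathcomp Require Import ring lra.

Set Implicit Arguments.
Unset Strict Implicit.
Unset Printing Implicit Defensive.

Import Order.TTheory GRing.Theory Num.Theory.
Import numFieldNormedType.Exports.

Local Open Scope classical_set_scope.
Local Open Scope ring_scope.

(** The problem is a fixed point problem in disguise. Truncating a function
   to the band between [alpha] and [beta] before inserting it into the
   equation, and integrating, defines an operator [picard] on C(I). All the
   truncated right-hand sides are dominated by one integrable function, so the
   image of [picard] is bounded and equicontinuous, and dominated convergence
   makes [picard] continuous; Schauder's theorem ([schauder_interval]) gives a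
   fixed point.

   Every fixed point lies between [alpha] and [beta]
   ([fixed_point_interval]): on I_- this is the condition on [Lambda], and
   wherever x < alpha on I_0 the truncation replaces x(t) by alpha(t) while
   the delayed value lies in E(t), so that x' >= alpha' there; [barrier] then
   forbids x to drop below alpha. What makes [barrier] work is that an
   absolutely continuous function with almost everywhere nonnegative
   derivative is nondecreasing ([absolutely_continuous_nondecreasing]). On the
   band truncation does nothing, so the fixed points of [picard] are exactly
   the solutions between [alpha] and [beta].

   The set of these solutions is nonempty, equicontinuous and closed under
   uniform limits. By equicontinuity the pointwise infimum of a chain of
   solutions is a uniform limit of members of the chain, hence a solution, and
   Zorn's lemma provides minimal and maximal solutions ([exists_minimal],
   [exists_maximal]).

   Schauder's theorem is reduced to Brouwer's theorem by replacing a function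
   with weighted means of its values on a finite net, followed by an
   Arzela-Ascoli argument ([uniform_subsequence]). Brouwer's theorem comes
   from a cubical Sperner lemma, proved by a mod 2 version of the Stokes
   computation of the integral of dl_1 ... dl_n over the cube.

   On the measure-theoretic side, the superposed right-hand side is only
   Lebesgue measurable ([measurable_superposition]); it is replaced by a
   Borel function equal to it almost everywhere ([borel_version]), to which
   Lebesgue differentiation and dominated convergence apply. *)

(** * A mod 2 cubical Sperner lemma *)

Section CubicalSperner.
Variables (I : finType) (p : nat).
Implicit Types (x q : I -> nat) (a b i : I) (A : {set I}) (s : seq I).
Local Notation point := (I -> nat).
Local Notation F2 := 'F_2.

Definition upd q a v : point := fun b => if b == a then v else q b.
Definition step q a : point := upd q a (q a).+1.

Lemma updxx q a v : upd q a v a = v.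
Proof. by rewrite /upd eqxx. Qed.

Lemma updx q a b v : b != a -> upd q a v b = q b.
Proof. by rewrite /upd => /negbTE ->. Qed.

Lemma upd_same q a v w : upd (upd q a v) a w = upd q a w.
Proof. by apply/funext => b; rewrite /upd; case: eqP. Qed.

Lemma updC q a b v w : a != b -> upd (upd q a v) b w = upd (upd q b w) a v.
Proof.
move=> ab; apply/funext => c; rewrite /upd.
by have [->|//] := eqVneq c b; rewrite eq_sym (negbTE ab).
Qed.

Lemma step_upd q a v : step (upd q a v) a = upd q a v.+1.
Proof. by rewrite /step upd_same updxx. Qed.

Lemma stepC q a b : step (step q a) b = step (step q b) a.
Proof.
have [->//|ab] := eqVneq a b.
by rewrite /step updC// !updx// eq_sym.
Qed.

Lemma addF2 (c : F2) : c + c = 0.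
Proof. by rewrite addrr_pchar2//; exact: pchar_Fp. Qed.

(** A cochain [c] assigns to a set [A] of directions and a lattice point [q] an
   element of F_2, its value on the unit cube with lower corner [q] and edges
   along [A]. Signs are irrelevant modulo 2. *)
Definition coboundary (c : {set I} -> point -> F2) A q : F2 :=
  \sum_(a in A) (c (A :\ a) (step q a) - c (A :\ a) q).

(** The terms of (a, b) and (b, a) cancel modulo 2. *)
Lemma sum_sym_pairs A (G : I -> I -> F2) : (forall a b, G a b = G b a) ->
  \sum_(a in A) \sum_(b in A :\ a) G a b = 0.
Proof.
move=> Gsym; rewrite pair_big_dep/=.
pose lt (ab : I * I) := (enum_rank ab.1 < enum_rank ab.2)%N.
rewrite (bigID lt)/=.
suff -> : \sum_(ab | (ab.1 \in A) && (ab.2 \in A :\ ab.1) && ~~ lt ab) G ab.1 ab.2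
  = \sum_(ab | (ab.1 \in A) && (ab.2 \in A :\ ab.1) && lt ab) G ab.1 ab.2.
  exact: addF2.
rewrite (reindex_inj (h := fun ab : I * I => (ab.2, ab.1)))/=; last first.
  by move=> [a b] [c d] /= [-> ->].
apply: eq_big => [[a b]|[a b] _] //=; rewrite /lt/= !inE.
have [->|ab] := eqVneq a b; first by rewrite /= !andbF.
rewrite -leqNgt leq_eqVlt (inj_eq val_inj) (inj_eq enum_rank_inj).
rewrite (negbTE ab)/=.
by case: (a \in A); case: (b \in A).
Qed.

Lemma coboundary_coboundary c A q : coboundary (coboundary c) A q = 0.
Proof.
pose G a b : F2 := c (A :\ a :\ b) (step (step q a) b) + c (A :\ a :\ b) (step q a)
  + c (A :\ a :\ b) (step q b) + c (A :\ a :\ b) q.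
have opp (u : F2) : - u = u by rewrite -[LHS]addr0 -(addF2 u) addKr.
transitivity (\sum_(a in A) \sum_(b in A :\ a) G a b).
  apply: eq_bigr => a aA; rewrite /coboundary -sumrB; apply: eq_bigr => b _.
  by rewrite /G !opp !addrA.
apply: sum_sym_pairs => a b; rewrite /G stepC.
have -> : A :\ a :\ b = A :\ b :\ a by rewrite !finset.setDDl finset.setUC.
by rewrite -!addrA; congr (_ + _); rewrite addrCA.
Qed.

Variable l : I -> point -> F2.

(** The cup product of the coboundaries of the labels in [s]: a sum over the
   monotone edge paths through the cube [(q, A)], the i-th edge carrying the
   increment of the i-th label. *)
Fixpoint cup s A q : F2 :=
  if s is i :: s' then
    \sum_(a in A) (l i (step q a) - l i q) * cup s' (A :\ a) (step q a)
  else 1.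

(** Leibniz rule d(l c) = dl c + l dc, where dc = 0. *)
Lemma cup_cons_closed i s : (forall A q, coboundary (cup s) A q = 0) ->
  cup (i :: s) = coboundary (fun A q => l i q * cup s A q).
Proof.
move=> cl; apply/funext => B; apply/funext => x.
transitivity (cup (i :: s) B x + l i x * coboundary (cup s) B x).
  by rewrite cl mulr0 addr0.
rewrite /= /coboundary mulr_sumr -big_split/=; apply: eq_bigr => a _; ring.
Qed.

Lemma cup_closed s A q : coboundary (cup s) A q = 0.
Proof.
elim: s A q => [|i s IH] A q.
  by rewrite /coboundary big1// => a _; rewrite subrr.
by rewrite (cup_cons_closed _ IH) coboundary_coboundary.
Qed.

Lemma cup_cons i s : cup (i :: s) = coboundary (fun A q => l i q * cup s A q).
Proof. exact/cup_cons_closed/cup_closed. Qed.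

(** Summation over a lattice box one direction at a time, so that the direction
   in which a sum telescopes can be moved to the front ([box_rem]). *)
Fixpoint box s (F : point -> F2) q : F2 :=
  if s is a :: s' then \sum_(v < p) box s' F (upd q a v) else F q.

Lemma eq_box s (F G : point -> F2) q : F =1 G -> box s F q = box s G q.
Proof. by move=> /funext ->. Qed.

Lemma box_sum s (K : Type) (r : seq K) (P : pred K) (F : K -> point -> F2) q :
  box s (fun x => \sum_(k <- r | P k) F k x) q = \sum_(k <- r | P k) box s (F k) q.
Proof.
elim: s q => [|a s IH] q //=.
by rewrite exchange_big/=; apply: eq_bigr => v _.
Qed.

Lemma box_upd s F q a v : a \notin s ->
  box s F (upd q a v) = box s (fun x => F (upd x a v)) q.
Proof.
elim: s q => [|b s IH] q //=; rewrite inE negb_or => /andP[ab as_].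
by apply: eq_bigr => w _; rewrite updC// IH.
Qed.

Lemma box_rem s F q a : uniq s -> a \in s ->
  box s F q = box (rem a s) (fun x => \sum_(v < p) F (upd x a v)) q.
Proof.
elim: s q => [|b s IH] q //= /andP[bs us].
have [ba|ba] := eqVneq b a.
  by move=> _; rewrite box_sum; apply: eq_bigr => v _; rewrite box_upd -?ba.
rewrite inE eq_sym (negbTE ba)/= => as_.
by apply: eq_bigr => v _; rewrite IH.
Qed.

(** Stokes: the sum telescopes in each direction [a], and only the faces
   x_a = p and x_a = 0 remain. *)
Lemma box_coboundary s A (c : {set I} -> point -> F2) q : uniq s -> s =i A ->
  box s (coboundary c A) q = \sum_(a in A)
    box (rem a s) (fun x => c (A :\ a) (upd x a p) - c (A :\ a) (upd x a 0)) q.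
Proof.
move=> us sA; rewrite box_sum; apply: eq_bigr => a aA.
rewrite (@box_rem _ _ _ a)//; last by rewrite sA.
apply: eq_box => x.
under eq_bigr do rewrite step_upd.
by rewrite -(big_mkord xpredT (fun v => c _ (upd x a v.+1) - c _ (upd x a v)))
  telescope_sumr.
Qed.

Hypothesis l0 : forall i x, x i = 0%N -> l i x = 0.
Hypothesis lp : forall i x, x i = p -> l i x = 1.

(** On a face x_a = 0 or x_a = p the label [l a] is constant, so its increments
   along the edges of a cube inside this face vanish. *)
Lemma cup_const_face s A q a : a \in s -> a \notin A ->
  q a = 0%N \/ q a = p -> cup s A q = 0.
Proof.
elim: s A q => [|i s IH] A q //=; rewrite inE => as_ aA qa.
apply: big1 => b bA.
have ab : a != b by apply: contraNneq aA => ->.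
have qb : step q b a = q a by rewrite /step /upd (negbTE ab).
case/predU1P: as_ => [ai|as_].
  rewrite -ai; case: qa => qa.
    by rewrite !l0 ?qb// subrr mul0r.
  by rewrite !lp ?qb// subrr mul0r.
by rewrite IH ?mulr0// ?qb// !inE (negbTE aA) andbF.
Qed.

(** The discrete degree is 1. For the first label [i], Stokes leaves the faces
   of all directions; those of directions other than [i] vanish by
   [cup_const_face], the face x_i = 0 vanishes because the label is 0 there,
   and on the face x_i = p the label is 1, which leaves the same sum in one
   dimension less. *)
Lemma box_cup s q : uniq s -> box s (cup s [set i in s]) q = 1.
Proof.
elim: s q => [|i s IH] q //; rewrite cons_uniq => /andP[is_ us].
rewrite cup_cons box_coboundary ?cons_uniq ?is_//; last by move=> j; rewrite !inE.
have box0 s' (F : point -> F2) : F =1 (fun=> 0) -> box s' F q = 0.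
  move=> F0; rewrite (eq_box _ _ F0); elim: s' q {F0 IH} => //= a s' IH q.
  exact: big1.
rewrite (bigD1 i) ?inE ?eqxx//= eqxx big1 => [|a]; last first.
  rewrite !inE => /andP[/predU1P[->|as_]] ai; first by rewrite eqxx in ai.
  apply: box0 => x.
  by rewrite !(@cup_const_face s _ _ a) ?mulr0 ?subrr// ?inE ?eqxx// /upd eqxx; [left|right].
rewrite addr0.
have -> : [set j in i :: s] :\ i = [set j in s].
  by apply/setP => j; rewrite !inE; have [->|] := eqVneq j i; rewrite ?(negbTE is_).
rewrite -(IH (upd q i p) us) box_upd//; apply: eq_box => x.
rewrite (@lp i) ?mul1r; last by rewrite /upd eqxx.
by rewrite (@l0 i) ?mul0r ?subr0// /upd eqxx.
Qed.

Lemma box_neq0 s F q : box s F q != 0 ->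
  exists2 x, F x != 0 & (forall i, i \in s -> (x i < p)%N) /\
                        (forall i, i \notin s -> x i = q i).
Proof.
elim: s q => [|a s IH] q /=; first by move=> Fq; exists q.
have [|/forallPn[v vn0] _] := boolP [forall v : 'I_p, box s F (upd q a v) == 0].
  by move=> /forallP h; rewrite big1 ?eqxx// => v _; apply/eqP/h.
have [x Fx [xs xns]] := IH _ vn0; exists x => //; split => i.
  rewrite inE; have [is_ _|is_ /orP[/eqP->|//]] := boolP (i \in s); first exact: xs.
  have [as_|as_] := boolP (a \in s); first exact: xs.
  by rewrite xns// /upd eqxx.
by rewrite inE negb_or => /andP[ia /xns]; rewrite /upd (negbTE ia).
Qed.

(** A nonzero summand of the cup product is a path in the cube along which every
   label changes. *)
Lemma cup_neq0 s A q : cup s A q != 0 -> forall i, i \in s ->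
  exists y z, l i y != l i z /\
   forall j, (q j <= y j <= q j + (j \in A))%N /\ (q j <= z j <= q j + (j \in A))%N.
Proof.
elim: s A q => [|i s IH] A q //= + j.
have [|/forallPn[a]] := boolP [forall a in A,
    (l i (step q a) - l i q) * cup s (A :\ a) (step q a) == 0].
  by move=> /forall_inP h; rewrite big1 ?eqxx// => a aA; apply/eqP/h.
rewrite negb_imply mulf_eq0 negb_or => /andP[aA /andP[li /IH{}IH]] _.
have sq b : (q b <= step q a b)%N && (step q a b + (b \in A :\ a) <= q b + (b \in A))%N.
  rewrite /step /upd !inE; have [->|ba] := eqVneq b a; first by rewrite aA/= addn0 addn1 leqnn leqnSn.
  by rewrite /= !leqnn.
rewrite inE => /predU1P[->|/IH[y [z [lyz yz]]]].
  exists (step q a), q; split; first by rewrite -subr_eq0.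
  move=> b; rewrite leqnn leq_addr; split=> //.
  have /andP[-> h] := sq b; apply: leq_trans h; exact: leq_addr.
exists y, z; split => // b.
have [/andP[y1 y2] /andP[z1 z2]] := yz b; have /andP[s1 s2] := sq b.
by rewrite (leq_trans s1 y1) (leq_trans s1 z1) (leq_trans y2 s2) (leq_trans z2 s2).
Qed.

End CubicalSperner.

(** Since the contributions of the cells add up to 1 modulo 2, some cell has a
   nonzero contribution, and every label takes both values at its vertices. *)
Lemma cubical_sperner (I : finType) (p : nat) (l : I -> (I -> nat) -> bool) :
  (forall i x, x i = 0%N -> l i x = false) ->
  (forall i x, x i = p -> l i x = true) ->
  exists q : I -> nat, (forall i, q i < p)%N /\
    forall i, exists y z : I -> nat, [/\ l i y = false, l i z = true &
      forall j, (q j <= y j <= (q j).+1)%N /\ (q j <= z j <= (q j).+1)%N].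
Proof.
move=> l0 lp; pose l2 i x : 'F_2 := (l i x)%:R.
have l20 i x : x i = 0%N -> l2 i x = 0 by rewrite /l2 => /l0 ->.
have l2p i x : x i = p -> l2 i x = 1 by rewrite /l2 => /lp ->.
have := box_cup l20 l2p (fun=> 0%N) (enum_uniq I).
set F := cup _ _ _ => boxF.
have /box_neq0[q Fq [qp _]] : box p (enum I) F (fun=> 0%N) != 0.
  by rewrite boxF oner_neq0.
exists q; split => i; first by apply: qp; rewrite mem_enum.
have [|y [z [lyz yz]]] := cup_neq0 Fq (i := i); first by rewrite mem_enum.
have {}yz j : (q j <= y j <= (q j).+1)%N /\ (q j <= z j <= (q j).+1)%N.
  by have := yz j; rewrite inE mem_enum inE addn1.
case ly : (l i y); case lz : (l i z); rewrite /l2 ly lz ?eqxx// in lyz.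
- by exists z, y; split => // j; have [] := yz j.
- by exists y, z.
Qed.

(** * Uniform cluster points *)

Section UniformCluster.
Context {R : realType}.

(** The part of equicontinuity and total boundedness of [J] that the
   Arzela-Ascoli argument uses. It is available for equicontinuous functions on
   a segment and, trivially, for a finite [T]. *)
Definition finite_nets (T : eqType) (J : set T) (u : nat -> T -> R) : Prop :=
  forall e : R, 0 < e -> exists2 s : seq T, (forall i, i \in s -> J i) &
    forall t, J t -> exists2 i, i \in s & forall n, `|u n t - u n i| <= e.

(** A cluster point in the product topology exists by Tychonoff's theorem.
   Closeness on the finite net at a common index propagates to all of [J],
   because the cluster point inherits the oscillation bounds of the net. *)
Lemma uniform_cluster (T : eqType) (J : set T) (u : nat -> T -> R) (M : R) :
  (forall n t, J t -> `|u n t| <= M) -> finite_nets J u ->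
  exists y : T -> R, forall e : R, 0 < e -> forall N : nat,
    exists2 n, (N <= n)%N & forall t, J t -> `|u n t - y t| <= e.
Proof.
move=> uM unet.
(* Off [J] the functions may be unbounded; 0 is a harmless value there. *)
pose v n t := if `[< J t >] then u n t else 0.
have vE n t : J t -> v n t = u n t by move=> Jt; rewrite /v asboolT.
have Kco := @tychonoff T (fun=> R) (fun=> `[- `|M|, `|M|]%classic)
  (fun=> @segment_compact _ _ _).
have [|y [_ yv]] := Kco ((fun n => v n : prod_topology (fun _ : T => R)) @ \oo) _.
  exists 0%N => // n _ t /=; rewrite in_itv/= -ler_norml /v.
  case: asboolP => Jt; last by rewrite normr0.
  by rewrite (le_trans (uM n t Jt))// ler_norm.
have nb (d : R) t : 0 < d ->
    nbhs (y : prod_topology (fun _ : T => R)) [set f | `|f t - y t| <= d].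
  move=> d0; have := @proj_continuous T (fun=> R) t y.
  move=> /(_ [set z | `|z - y t| <= d]); apply.
  apply/nbhs_ballP; exists d => //= z; rewrite /ball/= distrC; exact: ltW.
have nbs (d : R) (s : seq T) : 0 < d ->
    nbhs (y : prod_topology (fun _ : T => R))
      [set f | forall t, t \in s -> `|f t - y t| <= d].
  move=> d0; have FF : Filter (nbhs (y : prod_topology (fun _ : T => R))).
    exact: nbhs_filter.
  elim: s => [|t s IH]; first by apply: (@filterS _ _ FF setT) => //; exact: filterT.
  apply: (@filterS _ _ FF _ _ _ (@filterI _ _ FF _ _ (nb _ t d0) IH)) => f [/= ft fs] t'.
  by rewrite inE => /predU1P[->//|]; exact: fs.
have near (d : R) (s : seq T) N : 0 < d -> (forall t, t \in s -> J t) ->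
    exists2 n, (N <= n)%N & forall t, t \in s -> `|u n t - y t| <= d.
  move=> d0 sJ; have [|f [[n Nn <-] fs]] :=
    yv [set f | exists2 n, (N <= n)%N & v n = f] _ _ (nbs d s d0).
    by exists N => // n; exists n.
  by exists n => // t ts; rewrite -vE; [exact: fs|exact: sJ].
exists y => e e0 N; have e3 : 0 < e / 3 by lra.
have [s sJ snet] := unet _ e3.
have [n Nn ns] := near _ _ N e3 sJ; exists n => // t Jt.
have [i is_ ti] := snet t Jt.
have yti : `|y t - y i| <= e / 3.
  apply/ler_addgt0Pr => d d0; have d2 : 0 < d / 2 by lra.
  have [|m _ ms] := near _ [:: t; i] 0%N d2.
    by move=> j; rewrite !inE => /orP[]/eqP->//; exact: sJ.
  have := ti m; have := ms t; have := ms i; rewrite !inE !eqxx orbT/=.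
  move=> /(_ isT) + /(_ isT); rewrite !ler_norml; lra.
by have := ti n; have := ns i is_; move: yti; rewrite !ler_norml; lra.
Qed.

(** The indices [phi n] need not increase: [n <= phi n] is enough for error
   terms that tend to 0 along [n] to tend to 0 along [phi n]. *)
Lemma uniform_subsequence (T : eqType) (J : set T) (u : nat -> T -> R) (M : R) :
  (forall n t, J t -> `|u n t| <= M) -> finite_nets J u ->
  exists (y : T -> R) (phi : nat -> nat), forall n, (n <= phi n)%N /\
    forall t, J t -> `|u (phi n) t - y t| <= n.+1%:R^-1.
Proof.
move=> uM unet; have [y yP] := uniform_cluster uM unet.
have /choice[phi phiP] n : exists m, (n <= m)%N /\
    forall t, J t -> `|u m t - y t| <= n.+1%:R^-1.
  by have [|m nm h] := yP n.+1%:R^-1 _ n; [rewrite invr_gt0|exists m].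
by exists y, phi.
Qed.

End UniformCluster.

(** * Brouwer fixed point theorem on cubes *)

Section Brouwer.
Context {R : realType}.

Lemma cvg_harmonic_bound (u : nat -> R) (l c : R) :
  (forall n, `|u n - l| <= c * n.+1%:R^-1) -> u n @[n --> \oo] --> l.
Proof.
move=> ul; have c0 : (fun n => c * n.+1%:R^-1) @ \oo --> (0 : R).
  by rewrite -[X in _ --> X](mulr0 c); apply: cvgMr; exact: cvg_harmonic.
apply/cvgrPdist_le => e e0.
have /cvgrPdist_le /(_ e e0) := c0; apply: filterS => n.
rewrite sub0r normrN distrC => h; apply: le_trans (ul n) _.
by apply: le_trans h; exact: ler_norm.
Qed.

Definition in_cube (I : Type) (lo hi : R) (x : I -> R) := forall i, lo <= x i <= hi.

(** Label [i] records that [Phi] decreases the i-th coordinate; on the two faces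
   orthogonal to direction [i] it is forced to the values required by
   [cubical_sperner], consistently since [Phi] preserves the cube. In a cell where
   all labels take both values, every coordinate [i] has a vertex [Y i] at which
   it is not decreased and a vertex [Z i] at which it is not increased. *)
Lemma approximate_fixed_cells (I : finType) (lo hi : R)
    (Phi : (I -> R) -> I -> R) (n : nat) :
  lo <= hi -> (forall x, in_cube lo hi x -> in_cube lo hi (Phi x)) ->
  exists (x : I -> R) (Y Z : I -> I -> R), [/\ in_cube lo hi x,
    forall i, in_cube lo hi (Y i) /\ in_cube lo hi (Z i),
    forall i, Y i i <= Phi (Y i) i /\ Phi (Z i) i <= Z i i &
    forall i j, `|Y i j - x j| <= (hi - lo) * n.+1%:R^-1 /\
                `|Z i j - x j| <= (hi - lo) * n.+1%:R^-1].
Proof.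
move=> lohi PhiS; pose pt (g : I -> nat) i := lo + (hi - lo) * ((g i)%:R / n.+1%:R).
pose l i g := (g i != 0)%N && ((g i == n.+1) || (Phi (pt g) i < pt g i)).
have [i g gi|i g gi|q [qn qP]] := @cubical_sperner I n.+1 l.
- by rewrite /l gi.
- by rewrite /l gi eqxx.
have n0 : 0 < n.+1%:R :> R by rewrite ltr0n.
have ptS g : (forall i, (g i <= n.+1)%N) -> in_cube lo hi (pt g).
  move=> gn i; rewrite /pt.
  have g0 : 0 <= (g i)%:R / n.+1%:R :> R by rewrite divr_ge0.
  have g1 : (g i)%:R / n.+1%:R <= 1 :> R by rewrite ler_pdivrMr// mul1r ler_nat.
  have : 0 <= (hi - lo) * ((g i)%:R / n.+1%:R) by rewrite mulr_ge0// subr_ge0.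
  have : (hi - lo) * ((g i)%:R / n.+1%:R) <= hi - lo.
    by rewrite ler_piMr// subr_ge0.
  by move: (_ * _) => w w1 w0; apply/andP; split; lra.
have ptd g i : (q i <= g i <= (q i).+1)%N ->
    `|pt g i - pt q i| <= (hi - lo) * n.+1%:R^-1.
  move=> qg; rewrite /pt opprD addrACA subrr add0r -mulrBr -mulrBl mulrA normrM.
  rewrite [X in _ * X]gtr0_norm ?invr_gt0//.
  rewrite ler_wpM2r// ?invr_ge0 ?ler0n// normrM ger0_norm ?subr_ge0//.
  rewrite ler_piMr// ?subr_ge0// -natrB; last by case/andP: qg.
  by rewrite normr_nat (_ : 1 = 1%:R)// ler_nat leq_subLR addn1; case/andP: qg.
have /choice[y /choice[z yzP]] := qP.
have yz i j : (y i j <= n.+1)%N /\ (z i j <= n.+1)%N.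
  have [_ _ /(_ j)[/andP[_ h1] /andP[_ h2]]] := yzP i.
  by split; [exact: leq_trans h1 (qn j)|exact: leq_trans h2 (qn j)].
exists (pt q), (fun i => pt (y i)), (fun i => pt (z i)); split.
- by apply: ptS => i; exact/ltnW.
- by move=> i; split; apply: ptS => j; have [] := yz i j.
- move=> i; have [ly lz _] := yzP i; split.
    move: ly; rewrite /l; have [y0 _|_ /=] := eqVneq (y i i) 0%N.
      rewrite [pt _ i]/pt y0 mul0r mulr0 addr0.
      by have /PhiS/(_ i)/andP[] := ptS _ (fun j => (yz i j).1).
    by move=> /negbT; rewrite negb_or -leNgt => /andP[].
  move: lz; rewrite /l => /andP[_ /orP[/eqP zn|/ltW//]].
  rewrite [pt _ i]/pt zn divff ?gt_eqF// mulr1 addrC subrK.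
  by have /PhiS/(_ i)/andP[] := ptS _ (fun j => (yz i j).2).
- by move=> i j; have [_ _ /(_ j)[h1 h2]] := yzP i; split; exact: ptd.
Qed.

(** The cells of [approximate_fixed_cells] shrink as the mesh is refined, so
   that at a cluster point of the cells both inequalities pass to the limit. *)
Lemma brouwer_cube (I : finType) (lo hi : R) (Phi : (I -> R) -> I -> R) :
  lo <= hi -> (forall x, in_cube lo hi x -> in_cube lo hi (Phi x)) ->
  (forall (u : nat -> I -> R) x, (forall n, in_cube lo hi (u n)) ->
    in_cube lo hi x -> (forall i, u n i @[n --> \oo] --> x i) ->
    forall i, Phi (u n) i @[n --> \oo] --> Phi x i) ->
  exists x, in_cube lo hi x /\ Phi x =1 x.
Proof.
move=> lohi PhiS Phic.
have /choice[u /choice[Y /choice[Z uYZ]]] n :=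
  @approximate_fixed_cells I lo hi Phi n lohi PhiS.
have [||x [phi xphi]] := @uniform_subsequence R I setT u (`|lo| + `|hi|).
- move=> n i _; have [/(_ i) h _ _ _] := uYZ n.
  by move: h (ler_norm lo) (ler_norm (- lo)) (ler_norm hi) (ler_norm (- hi)) (normr_ge0 lo) (normr_ge0 hi); rewrite !normrN ler_norml; lra.
- move=> e e0; exists (enum I) => // i _; exists i; first by rewrite mem_enum.
  by move=> n; rewrite subrr normr0 ltW.
have ux i : u (phi n) i @[n --> \oo] --> x i.
  apply: (@cvg_harmonic_bound _ _ 1) => n; rewrite mul1r.
  by have [_ ->] := xphi n.
have lim_ge (v : nat -> R) l c : (forall n, c <= v n) -> v n @[n --> \oo] --> l -> c <= l.
  by move=> cv vl; rewrite -(cvg_lim (@Rhausdorff R) vl); apply: limr_ge;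
    [apply/cvg_ex; exists l|exact: nearW].
have lim_le (v : nat -> R) l c : (forall n, v n <= c) -> v n @[n --> \oo] --> l -> l <= c.
  by move=> cv vl; rewrite -(cvg_lim (@Rhausdorff R) vl); apply: limr_le;
    [apply/cvg_ex; exists l|exact: nearW].
have xS : in_cube lo hi x.
  move=> i; apply/andP; split; [apply: lim_ge (ux i)|apply: lim_le (ux i)] => n;
    by have [/(_ i)/andP[]] := uYZ (phi n).
have near_x (V : nat -> I -> I -> R) i j :
    (forall n, `|V n i j - u n j| <= (hi - lo) * n.+1%:R^-1) ->
    V (phi n) i j @[n --> \oo] --> x j.
  move=> Vu; apply: (@cvg_harmonic_bound _ _ (hi - lo + 1)) => n.
  rewrite mulrDl mul1r -(subrK (u (phi n) j) (V _ _ _)) -addrA.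
  have [nphi /(_ j Logic.I) h2] := xphi n.
  apply: le_trans (ler_normD _ _) (lerD (le_trans (Vu _) _) h2).
  rewrite ler_wpM2l ?subr_ge0// lef_pV2 ?posrE ?ltr0n// ler_nat.
  by [].
exists x; split => // i.
have Yx : forall j, Y (phi n) i j @[n --> \oo] --> x j.
  by move=> j; apply: near_x => n; have [_ _ _ /(_ i j)[]] := uYZ n.
have Zx : forall j, Z (phi n) i j @[n --> \oo] --> x j.
  by move=> j; apply: near_x => n; have [_ _ _ /(_ i j)[]] := uYZ n.
have YS n : in_cube lo hi (Y (phi n) i) by have [_ /(_ i)[]] := uYZ (phi n).
have ZS n : in_cube lo hi (Z (phi n) i) by have [_ /(_ i)[]] := uYZ (phi n).
apply/eqP; rewrite eq_le; apply/andP; split; rewrite -subr_ge0.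
- apply: lim_ge (cvgB (Zx i) (Phic _ _ ZS xS Zx i)) => n.
  by have [_ _ /(_ i)[_]] := uYZ (phi n); rewrite -subr_ge0.
- apply: lim_ge (cvgB (Phic _ _ YS xS Yx i) (Yx i)) => n.
  by have [_ _ /(_ i)[h _] _] := uYZ (phi n); rewrite -subr_ge0 in h.
Qed.

End Brouwer.

(** * Schauder fixed point theorem on a segment *)

Section Schauder.
Context {R : realType}.
Implicit Types (A B : R) (x y : R -> R).

Lemma CspaceP A B x : Cspace `[A, B] x <->
  (forall t, A <= t <= B -> forall e, 0 < e -> exists2 d, 0 < d &
     forall s, A <= s <= B -> `|s - t| < d -> `|x s - x t| <= e) /\
  (forall t, ~ A <= t <= B -> x t = 0).
Proof.
have itvE t : (`[A, B]%classic t : Prop) = (A <= t <= B) by rewrite /= in_itv.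
have offE : (forall t, ~ `[A, B]%classic t -> x t = 0) <->
    (forall t, ~ A <= t <= B -> x t = 0).
  by split=> h t; have := h t; rewrite itvE.
split=> -[xc x0]; split; try by apply/offE.
- move=> t tAB e e0; move/subspace_continuousP: xc => /(_ t).
  rewrite itvE => /(_ tAB)/cvgrPdist_le/(_ e e0).
  rewrite near_withinE => /nbhs_ballP[d /= d0 dP]; exists d => // s sAB st.
  by rewrite distrC; apply: dP; rewrite ?itvE// /ball/= distrC.
- apply/subspace_continuousP => t; rewrite itvE => tAB.
  apply/cvgrPdist_le => e e0; have [d d0 dP] := xc t tAB e e0.
  rewrite near_withinE; apply/nbhs_ballP; exists d => //= s st sAB.
  by rewrite distrC; apply: dP; rewrite -?itvE// distrC.
Qed.

Definition uniformly_cvg (J : set R) (u : nat -> R -> R) x :=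
  forall e, 0 < e -> exists N, forall n, (N <= n)%N ->
    forall t, J t -> `|u n t - x t| <= e.

Definition equicontinuous_family A B (F : set (R -> R)) :=
  forall e, 0 < e -> exists2 d, 0 < d &
    forall x, F x -> forall s t, A <= s <= B -> A <= t <= B ->
      `|s - t| < d -> `|x s - x t| <= e.

Lemma segment_net A B d : 0 < d -> exists2 s : seq R,
  (forall i, i \in s -> A <= i <= B) &
  (forall t, A <= t <= B -> exists2 i, i \in s & `|t - i| < d).
Proof.
move=> d0; have d2 : 0 < d / 2 by lra.
(* Spacing d / 2 keeps the point just below t at distance less than d. *)
exists [seq i <- [seq A + (d / 2) * n%:R | n <- iota 0 (Num.trunc ((B - A) / (d / 2))).+1] |
  A <= i <= B] => [i|t /andP[At tB]].
  by rewrite mem_filter => /andP[].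
have q0 : 0 <= (t - A) / (d / 2) by rewrite divr_ge0 ?subr_ge0// ltW.
have /andP[n1 n2] := truncn_itv q0; set n := Num.trunc _ in n1 n2.
rewrite ler_pdivlMr// in n1; rewrite ltr_pdivrMr// -natr1 in n2.
exists (A + d / 2 * n%:R); last by rewrite ltr_norml; apply/andP; split; nra.
rewrite mem_filter; apply/andP; split.
  apply/andP; split; last by nra.
  by rewrite lerDl mulr_ge0// ltW.
apply/mapP; exists n => //; rewrite mem_iota/= add0n ltnS; apply: Num.Theory.le_truncn.
by rewrite ler_pM2r ?invr_gt0// lerB.
Qed.

Lemma equicontinuous_nets A B (F : set (R -> R)) (u : nat -> R -> R) :
  equicontinuous_family A B F -> (forall n, F (u n)) ->
  finite_nets `[A, B]%classic u.
Proof.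
move=> Fe uF e e0; have [d d0 dP] := Fe e e0; have [s sAB sd] := segment_net A B d0.
exists s => [i /sAB|t]; rewrite /= in_itv//= => tAB.
have [i is_ ti] := sd t tAB; exists i => // n.
by apply: dP => //; exact: sAB.
Qed.

Lemma harmonic_le (e : R) : 0 < e ->
  exists N, forall n, (N <= n)%N -> n.+1%:R^-1 <= e.
Proof.
move=> e0; have /cvgrPdist_le/(_ e e0)[N _ NP] := @cvg_harmonic R.
exists N => n /NP; rewrite /= sub0r normrN ger0_norm//.
Qed.

Lemma equicontinuous_Cspace A B x : equicontinuous_family A B [set x] ->
  (forall t, ~ A <= t <= B -> x t = 0) -> Cspace `[A, B] x.
Proof.
move=> xe x0; apply/CspaceP; split => // t tAB e e0.
by have [d d0 dP] := xe e e0; exists d => // s sAB; exact: dP.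
Qed.

(** The modulus of continuity of a family passes to its uniform limits. *)
Lemma equicontinuous_family_limit A B (F : set (R -> R)) y :
  equicontinuous_family A B F ->
  (forall e, 0 < e -> exists2 x, F x &
     forall t, A <= t <= B -> `|x t - y t| <= e) ->
  equicontinuous_family A B [set y].
Proof.
move=> Fe Fy e e0; have [d d0 dP] := Fe e e0; exists d => // _ -> s t sAB tAB st.
apply/ler_addgt0Pr => e' e'0; have e2 : 0 < e' / 2 by lra.
have [x Fx xy] := Fy _ e2.
move: (xy s sAB) (xy t tAB) (dP x Fx s t sAB tAB st); rewrite !ler_norml; lra.
Qed.

Section weighted_means.
Variables (A B d : R) (s : seq R).
Let I := 'I_(size s).
Hypothesis d0 : 0 < d.
Hypothesis sd : forall t, A <= t <= B -> exists2 i, i \in s & `|t - i| < d.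

(** Schauder projection: [local_mean c t] is a convex combination of the values
   [c i] at the net points closer than [d] to [t]. *)
Definition net_point (i : I) : R := s`_i.
Definition hat (i : I) (t : R) : R := Num.max 0 (d - `|t - net_point i|).
Definition local_mean (c : I -> R) : R -> R := fun t =>
  if A <= t <= B then (\sum_i c i * hat i t) / \sum_i hat i t else 0.

Lemma hat_ge0 i t : 0 <= hat i t.
Proof. by rewrite /hat le_max lexx. Qed.

Lemma hat_gt0 t : A <= t <= B -> 0 < \sum_i hat i t.
Proof.
move=> tAB; have [x xs tx] := sd tAB.
have ix : (index x s < size s)%N by rewrite index_mem.
rewrite (bigD1 (Ordinal ix))//= ltr_pwDl//; last by apply: sumr_ge0 => i _; exact: hat_ge0.
by rewrite /hat lt_max /net_point/= nth_index// subr_gt0 tx orbT.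
Qed.

Lemma local_mean_dist c t z e : A <= t <= B ->
  (forall i, `|t - net_point i| < d -> `|c i - z| <= e) -> `|local_mean c t - z| <= e.
Proof.
move=> tAB ce; rewrite /local_mean tAB; have W0 := hat_gt0 tAB.
rewrite -[z in X in X <= _](mulfK (lt0r_neq0 W0)) -mulrBl normrM.
rewrite [X in _ * X]gtr0_norm ?invr_gt0// ler_pdivrMr//.
rewrite !mulr_sumr -sumrB; apply: le_trans (ler_norm_sum _ _ _) _.
apply: ler_sum => i _; rewrite -mulrBl normrM (ger0_norm (hat_ge0 _ _)).
have [td|td] := ltP `|t - net_point i| d.
  by rewrite ler_wpM2r// ?hat_ge0// ce.
by rewrite /hat max_l ?mulr0// subr_le0.
Qed.

Lemma local_mean_diff c c' t : local_mean c t - local_mean c' t = local_mean (fun i => c i - c' i) t.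
Proof.
rewrite /local_mean; case: ifP => _; last by rewrite subrr.
by rewrite -mulrBl -sumrB; under eq_bigr do rewrite -mulrBl.
Qed.

Lemma hat_continuous i : continuous (hat i).
Proof.
apply: (@max_fun_continuous _ R R (fun=> 0) (fun t => d - `|t - net_point i|)) => t.
  exact: cvg_cst.
apply: cvgB; first exact: cvg_cst.
by apply: cvg_norm; apply: cvgB; [exact: cvg_id|exact: cvg_cst].
Qed.

Lemma local_mean_Cspace c : Cspace `[A, B] (local_mean c).
Proof.
split=> [|t]; last by rewrite /= in_itv/= /local_mean => /negP/negbTE ->.
pose g t := (\sum_i c i * hat i t) / \sum_i hat i t.
apply: (@subspace_eq_continuous _ _ _ g).
  by move=> t; rewrite inE/= in_itv/= => tAB; rewrite /from_subspace /local_mean tAB.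
apply: continuous_in_subspaceT => t; rewrite inE/= in_itv/= => tAB.
apply: cvgM.
  apply: (cvg_big (@add_continuous R)) => i _; apply: cvgM; first exact: cvg_cst.
  exact: hat_continuous.
apply: cvgV; first by rewrite gt_eqF// hat_gt0.
by apply: (cvg_big (@add_continuous R)) => i _; exact: hat_continuous.
Qed.

End weighted_means.

(** For each precision, Brouwer's theorem applied to
   c |-> (T (local_mean c) (net_point i))_i yields x = local_mean c with
   c i = T x (net_point i), and equicontinuity of the image makes x close to
   T x. A uniform cluster point of the functions T x is then a fixed point. *)
Theorem schauder_interval A B (T : (R -> R) -> R -> R) (M : R) :
  A <= B ->
  (forall x, Cspace `[A, B] x -> Cspace `[A, B] (T x)) ->
  (forall x, Cspace `[A, B] x -> forall t, A <= t <= B -> `|T x t| <= M) ->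
  equicontinuous_family A B [set T x | x in Cspace `[A, B]] ->
  (forall u x, (forall n, Cspace `[A, B] (u n)) -> Cspace `[A, B] x ->
     uniformly_cvg `[A, B] u x ->
     forall t, A <= t <= B -> T (u n) t @[n --> \oo] --> T x t) ->
  exists2 x, Cspace `[A, B] x & T x = x.
Proof.
move=> AB TC TM Te Tc.
have C0 : Cspace `[A, B] (fun=> 0 : R).
  by apply/CspaceP; split => // t tAB e e0; exists 1 => // s _ _; rewrite subrr normr0 ltW.
have M0 : 0 <= M by apply: le_trans (TM _ C0 A _); rewrite ?lexx.
have approx n : exists x, Cspace `[A, B] x /\
    forall t, A <= t <= B -> `|x t - T x t| <= n.+1%:R^-1.
  have e0 : 0 < n.+1%:R^-1 :> R by rewrite invr_gt0.
  have [d d0 dP] := Te _ e0; have [s sAB sd] := segment_net A B d0.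
  have nodeAB i : A <= net_point (s := s) i <= B by apply/sAB/mem_nth.
  pose P := local_mean A B d (s := s); have PC c : Cspace `[A, B] (P c).
    exact: local_mean_Cspace.
  have [|||c [_ cP]] := @brouwer_cube R _ (- M) M (fun c i => T (P c) (net_point i)).
  - by rewrite ge0_cp.
  - by move=> c _ i; rewrite -ler_norml; apply: TM.
  - move=> u c _ _ uc i; apply: Tc => // e e1.
    have : \forall n \near \oo, forall i, `|u n i - c i| <= e.
      apply: filter_forall => j; have /cvgrPdist_le/(_ e e1) := uc j.
      by apply: filterS => k; rewrite distrC.
    move=> [N _ NP]; exists N => k Nk t tAB; rewrite local_mean_diff -[X in `|X|]subr0.
    by apply: local_mean_dist => // j _; rewrite subr0; exact: NP.
  exists (P c); split => // t tAB; apply: local_mean_dist => // i ti.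
  by rewrite -cP; apply: dP => //; [exists (P c)|rewrite distrC].
have /choice[x xP] := approx.
have [||y0 [phi yphi]] := @uniform_subsequence R R `[A, B]%classic (fun n => T (x n)) M.
- by move=> n t; rewrite /= in_itv/= => tAB; apply: TM tAB; exact: (xP n).1.
- by apply: (equicontinuous_nets Te) => n; exists (x n) => //; exact: (xP n).1.
(* Elements of the function space are extended by 0. *)
pose y t := if A <= t <= B then y0 t else 0.
have Ty n t : A <= t <= B -> `|T (x (phi n)) t - y t| <= n.+1%:R^-1.
  by move=> tAB; rewrite /y tAB; apply: (yphi n).2; rewrite /= in_itv.
have yC : Cspace `[A, B] y.
  apply: equicontinuous_Cspace; last by move=> t; rewrite /y => /negP/negbTE ->.
  apply: (equicontinuous_family_limit Te) => e e0.
  have [N NP] := harmonic_le e0.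
  exists (T (x (phi N))); first by exists (x (phi N)) => //; exact: (xP _).1.
  by move=> t tAB; apply: le_trans (Ty _ _ tAB) (NP _ _).
exists y => //; apply/funext => t.
have [tAB|tAB] := boolP (A <= t <= B); last first.
  have ntAB : ~ `[A, B]%classic t by rewrite /= in_itv/=; exact/negP.
  by rewrite (TC _ yC).2//; rewrite /y (negbTE tAB).
have Txy : T (x (phi n)) t @[n --> \oo] --> y t.
  by apply: (@cvg_harmonic_bound _ _ _ 1) => n; rewrite mul1r; exact: Ty.
apply: cvg_unique Txy => //; apply: Tc => // [n|e e0]; first exact: (xP _).1.
have e2 : 0 < e / 2 by lra.
have [N NP] := harmonic_le e2; exists N => n Nn s; rewrite /= in_itv/= => sAB.
have h1 := (xP (phi n)).2 s sAB; have h2 := Ty n s sAB.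
have h3 := NP n Nn; have h4 := NP (phi n) (leq_trans Nn (yphi n).1).
move: (le_trans h1 h4) (le_trans h2 h3); rewrite !ler_norml; lra.
Qed.

End Schauder.

(** * Minimal and maximal elements of equicontinuous families *)

Section MinimalElements.
Context {R : realType}.
Variables (A B : R).
Local Notation J := (`[A, B]%classic : set R).

(** On a finite net a single member of the chain is close to the infimum, since
   finitely many members of a chain have a least one; equicontinuity extends
   this closeness to the whole segment. *)
Lemma chain_infimum (C : set (R -> R)) (M : R) :
  C !=set0 -> C `<=` Cspace J -> equicontinuous_family A B C ->
  (forall x, C x -> forall t, A <= t <= B -> `|x t| <= M) ->
  (forall x y, C x -> C y -> le_on J x y \/ le_on J y x) ->
  exists y, [/\ Cspace J y, forall x, C x -> le_on J y x &
    forall e, 0 < e -> exists2 x, C x & forall t, A <= t <= B -> `|x t - y t| <= e].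
Proof.
move=> [x0 Cx0] CC Ce CM Ctot.
pose y t := if A <= t <= B then inf [set x t | x in C] else 0.
have ylb t : A <= t <= B -> has_lbound [set x t | x in C].
  move=> tAB; exists (- M) => _ [x Cx <-].
  by have := CM x Cx t tAB; rewrite ler_norml => /andP[].
have yle x t : C x -> A <= t <= B -> y t <= x t.
  by move=> Cx tAB; rewrite /y tAB; apply: ge_inf; [exact: ylb|exists x].
have yge c t : A <= t <= B -> (forall x, C x -> c <= x t) -> c <= y t.
  move=> tAB cx; rewrite /y tAB; apply: lb_le_inf; first by exists (x0 t), x0.
  by move=> _ [x Cx <-]; exact: cx.
have yapprox e : 0 < e -> exists2 x, C x & forall t, A <= t <= B -> `|x t - y t| <= e.
  move=> e0; have e3 : 0 < e / 3 by lra.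
  have [d d0 dP] := Ce _ e3; have [s sAB sd] := segment_net A B d0.
  have [x Cx xs] : exists2 x, C x & forall i, i \in s -> x i <= y i + e / 3.
    elim: s sAB {sd} => [|i s IH] sAB; first by exists x0.
    have [j js|x Cx xs] := IH; first by apply: sAB; rewrite inE js orbT.
    have iAB : A <= i <= B by apply: sAB; rewrite inE eqxx.
    have [x' Cx' x'i] : exists2 x', C x' & x' i <= y i + e / 3.
      apply: contrapT => no; suff : y i + e / 3 <= y i by lra.
      apply: yge => // x' Cx'; rewrite leNgt; apply/negP => x'i.
      by apply: no; exists x' => //; exact: ltW.
    have jAB j : j \in s -> J j by move=> js; rewrite /= in_itv/=; apply: sAB; rewrite inE js orbT.
    have [xx'|x'x] := Ctot x x' Cx Cx'; [exists x => // j|exists x' => // j];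
      rewrite inE => /predU1P[->|js] //; try exact: xs.
      by apply: le_trans x'i; apply: xx'; rewrite /= in_itv.
    by apply: le_trans (xs j js); apply: x'x; exact: jAB.
  exists x => // t tAB; have [i is_ ti] := sd t tAB; have iAB := sAB i is_.
  have yit : y i - e / 3 <= y t.
    apply: yge => // z Cz; have := dP z Cz t i tAB iAB ti; have := yle z i Cz iAB.
    rewrite ler_norml; lra.
  have := dP x Cx t i tAB iAB ti; have := xs i is_; have := yle x t Cx tAB.
  rewrite !ler_norml; lra.
exists y; split => //; last by move=> x Cx t; rewrite /= in_itv/=; exact: yle.
apply: equicontinuous_Cspace; last by move=> t; rewrite /y => /negP/negbTE ->.
exact: (equicontinuous_family_limit Ce).
Qed.

Lemma le_on_anti x y : Cspace J x -> Cspace J y -> le_on J x y -> le_on J y x -> x = y.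
Proof.
move=> [_ x0] [_ y0] xy yx; apply/funext => t.
have [Jt|nJt] := pselect (J t); last by rewrite x0// y0.
by apply/eqP; rewrite eq_le xy// yx.
Qed.

Lemma exists_minimal (S : set (R -> R)) (M : R) :
  S !=set0 -> S `<=` Cspace J -> equicontinuous_family A B S ->
  (forall x, S x -> forall t, A <= t <= B -> `|x t| <= M) ->
  (forall y, Cspace J y -> (forall e, 0 < e -> exists2 x, S x &
     forall t, A <= t <= B -> `|x t - y t| <= e) -> S y) ->
  exists2 x, S x & forall y, S y -> le_on J y x -> y = x.
Proof.
move=> [x0 Sx0] SC Se SM Scl; pose T := {x : R -> R | S x}.
(* The order is reversed so that a maximal element for [ge] is minimal. *)
pose ge (x y : T) := `[< le_on J (sval y) (sval x) >].
have [|||D Dtot|[x Sx] xmin] := @Zorn T ge.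
- by move=> x; apply/asboolP.
- move=> x y z /asboolP xy /asboolP yz; apply/asboolP => t Jt.
  by apply: le_trans (xy t Jt); exact: yz.
- move=> [x Sx] [y Sy] /asboolP/= yx /asboolP/= xy; apply: eq_exist.
  by apply: le_on_anti => //; exact: SC.
- have [D0|/nonemptyPn D0] := pselect (D !=set0); last first.
    by exists (exist _ x0 Sx0) => z Dz; move: Dz; rewrite D0.
  have DS : sval @` D `<=` S by move=> _ [[x Sx] _ <-].
  have [|||||y [Cy yD yapp]] := @chain_infimum (sval @` D) M.
  + by case: D0 => z Dz; exists (sval z), z.
  + by move=> x /DS; exact: SC.
  + by move=> e e0; have [d d0 dP] := Se e e0; exists d => // x /DS; exact: dP.
  + by move=> x /DS; exact: SM.
  + move=> _ _ [x Dx <-] [y Dy <-]; by have [/asboolP|/asboolP] := Dtot _ _ Dx Dy; [right|left].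
  have Sy : S y.
    by apply: Scl => // e e0; have [x /DS Sx xy] := yapp e e0; exists x.
  by exists (exist _ y Sy) => z Dz; apply/asboolP; apply: yD; exists z.
exists x => // y Sy yx; have := xmin (exist _ y Sy) (asboolT yx).
by move=> /(congr1 sval).
Qed.

Lemma CspaceN x : Cspace J x -> Cspace J (\- x).
Proof.
move=> /CspaceP[xc x0]; apply/CspaceP; split => t tAB.
  move=> e e0; have [d d0 dP] := xc t tAB e e0; exists d => // s sAB st.
  by rewrite -opprD normrN; exact: dP.
by rewrite /= x0// oppr0.
Qed.

Lemma exists_maximal (S : set (R -> R)) (M : R) :
  S !=set0 -> S `<=` Cspace J -> equicontinuous_family A B S ->
  (forall x, S x -> forall t, A <= t <= B -> `|x t| <= M) ->
  (forall y, Cspace J y -> (forall e, 0 < e -> exists2 x, S x &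
     forall t, A <= t <= B -> `|x t - y t| <= e) -> S y) ->
  exists2 x, S x & forall y, S y -> le_on J x y -> y = x.
Proof.
move=> [x0 Sx0] SC Se SM Scl.
have NN (x : R -> R) : \- (\- x) = x by apply/funext => t /=; rewrite opprK.
have [|||||x Sx xmin] := @exists_minimal [set x | S (\- x)] M.
- by exists (\- x0); rewrite /= NN.
- by move=> x /SC/CspaceN; rewrite NN.
- move=> e e0; have [d d0 dP] := Se e e0; exists d => // x Sx s t sAB tAB st.
  by rewrite -normrN opprD; exact: (dP _ Sx).
- by move=> x Sx t tAB; rewrite -normrN; exact: (SM _ Sx).
- move=> y Cy yapp; apply: Scl; first exact: CspaceN.
  move=> e e0; have [x Sx xy] := yapp e e0; exists (\- x) => // t tAB.
  by rewrite -opprD normrN; exact: xy.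
exists (\- x) => // y Sy xy; rewrite -(NN y); congr (\- _).
by apply: xmin; [rewrite /= NN|move=> t Jt /=; rewrite lerNl; exact: xy].
Qed.

End MinimalElements.

(** * Monotonicity of absolutely continuous functions *)

Section AbsolutelyContinuousMonotone.
Context {R : realType}.
Local Notation mu := (@lebesgue_measure R).

(** A transitive relation that holds on all small intervals around each point
   holds between the endpoints of a segment. *)
Lemma creeping (a b : R) (Q : R -> R -> Prop) : a <= b ->
  (forall s t w, s <= t -> t <= w -> Q s t -> Q t w -> Q s w) ->
  (forall c, a <= c <= b -> exists2 d, 0 < d & forall s t,
     a <= s -> s <= c -> c <= t -> t <= b -> c - s < d -> t - c < d -> Q s t) ->
  Q a b.
Proof.
move=> ab Qtrans Qloc.
pose S := [set s | a <= s <= b /\ Q a s].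
have Sa : S a.
  have [|d d0 dP] := Qloc a; first by rewrite lexx.
  by split; [rewrite lexx|apply: dP; rewrite ?lexx// subrr].
have Sub : has_ubound S by exists b => s [/andP[]].
have ac : a <= sup S by exact: ub_le_sup.
have cb : sup S <= b by apply: ge_sup; [exists a|move=> s [/andP[]]].
have [|d d0 dP] := Qloc (sup S); first by rewrite ac.
have [s [/andP[as_ sb] Qs] cs] : exists2 s, S s & sup S - d < s.
  by apply: sup_adherent => //; split; [exists a|].
have sc : s <= sup S by apply: ub_le_sup => //; split => //; rewrite as_.
pose t := Num.min b (sup S + d / 2).
have tb : t <= b by rewrite /t ge_min lexx.
have ct : sup S <= t by rewrite /t le_min cb lerDl; lra.
have tc : t - sup S < d.
  by rewrite ltrBlDr (@le_lt_trans _ _ (sup S + d / 2))// ?ge_min ?lexx ?orbT//; lra.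
have Qt : Q a t by apply: Qtrans Qs _ => //; [exact: le_trans ct|apply: dP => //; lra].
have : t <= sup S.
  by apply: ub_le_sup => //; split => //; rewrite tb (le_trans ac ct).
rewrite {1}/t ge_min => /orP[bc|]; last by move=> h; exfalso; lra.
by have -> : b = t by apply/eqP; rewrite eq_le tb (le_trans bc ct).
Qed.

Lemma derivable_slope_lower (g : R -> R) (c : R) : derivable g c 1 -> 0 <= derive1 g c ->
  forall e, 0 < e -> exists2 d, 0 < d & forall s t,
     s <= c -> c <= t -> c - s < d -> t - c < d -> - (e * (t - s)) <= g t - g s.
Proof.
move=> gc gc0 e e0.
have : h^-1 *: (g (h + c) - g c) @[h --> 0^'] --> derive1 g c.
  rewrite derive1E /derive; apply: cvg_trans gc.
  by apply: near_eq_cvg; near=> h; rewrite /= [h%:A]mulr1.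
move=> /cvgrPdist_le/(_ e e0); rewrite near_withinE => /nbhs_ballP[d /= d0 dP].
exists d => // s t sc ct csd tcd.
have slope h : `|h| < d -> h != 0 -> - e <= h^-1 * (g (h + c) - g c).
  move=> hd h0; have := dP h; rewrite /ball/= sub0r normrN => /(_ hd h0).
  rewrite /GRing.scale/= ler_norml; lra.
have right : - (e * (t - c)) <= g t - g c.
  have [->|tc] := eqVneq t c; first by rewrite !subrr mulr0 oppr0.
  have tc0 : 0 < t - c by rewrite subr_gt0 lt_neqAle eq_sym tc.
  have := slope (t - c); rewrite gtr0_norm// gt_eqF// subrK => /(_ tcd isT).
  by rewrite mulrC ler_pdivlMr// mulNr.
have left_ : - (e * (c - s)) <= g c - g s.
  have [->|sc'] := eqVneq s c; first by rewrite !subrr mulr0 oppr0.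
  have sc0 : 0 < c - s by rewrite subr_gt0 lt_neqAle sc'.
  have := slope (s - c); rewrite distrC gtr0_norm// subrK -(opprB c s) oppr_eq0 gt_eqF//.
  move=> /(_ csd isT); rewrite invrN mulNr -mulrN opprB mulrC ler_pdivlMr//.
  by rewrite mulNr.
lra.
Unshelve. all: by end_near. Qed.

Lemma disjoint_intervals_measure n (u v : 'I_n -> R) : (forall i, u i <= v i) ->
  trivIset setT (fun i => [set` `]u i, v i[]) ->
  mu (\big[setU/set0]_(i < n) [set` `]u i, v i[]) = (\sum_(i < n) (v i - u i))%:E.
Proof.
move=> uv tr; rewrite measure_semi_additive_ord//=; last exact: bigsetU_measurable.
rewrite -sumEFin; apply: eq_bigr => i _.
rewrite lebesgue_measure_itv/= lte_fin; case: ltP => // vu.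
by rewrite (_ : v i = u i) ?subrr//; apply/eqP; rewrite eq_le vu uv.
Qed.

(** The recursive form makes chains over adjacent segments concatenate. *)
Fixpoint interval_chain (U : set R) (s : R) (l : seq (R * R)) (t : R) : Prop :=
  if l is uv :: l' then [/\ s <= uv.1, uv.1 <= uv.2, `[uv.1, uv.2] `<=` U &
                            interval_chain U uv.2 l' t]
  else s <= t.

Lemma chain_weaken U s s' l t : s <= s' -> interval_chain U s' l t -> interval_chain U s l t.
Proof.
case: l => [|uv l] /= ss'; first exact: le_trans.
by move=> [su uv12 U12 c]; split => //; exact: le_trans su.
Qed.

Lemma chain_cat U s l t l' w : interval_chain U s l t -> interval_chain U t l' w ->
  interval_chain U s (l ++ l') w.
Proof.
elim: l s => [|uv l IH] s /=; first exact: chain_weaken.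
by move=> [su uv12 U12 c] c'; split => //; exact: IH.
Qed.

Lemma chain_le U s l t : interval_chain U s l t -> s <= t.
Proof.
elim: l s => [|uv l IH] s //= [su uv12 _ /IH].
by move=> vt; apply: le_trans su (le_trans uv12 vt).
Qed.

Lemma chain_nth U s l t : interval_chain U s l t -> forall i, (i < size l)%N ->
  let uv := nth (0, 0) l i in
  [/\ s <= uv.1, uv.1 <= uv.2, uv.2 <= t & `[uv.1, uv.2] `<=` U].
Proof.
elim: l s => [|uv l IH] s //= [su uv12 U12 c] [|i] /=.
  by move=> _; split => //; exact: chain_le c.
rewrite ltnS => il; have [h1 h2 h3 h4] := IH _ c i il; split => //.
by apply: le_trans su (le_trans uv12 h1).
Qed.

Lemma chain_ordered U s l t : interval_chain U s l t -> forall i j, (i < j < size l)%N ->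
  (nth (0, 0) l i).2 <= (nth (0, 0) l j).1.
Proof.
elim: l s => [|uv l IH] s; first by move=> _ i j; rewrite ltn0 andbF.
move=> /= [su uv12 U12 c] [|i] [|j] //=; rewrite ltnS => jl.
  by have [] := chain_nth c jl.
exact: IH c _ _ jl.
Qed.

(** Cover the exceptional null set by an open set [U] of small measure. Around a
   point with nonnegative derivative, g decreases at most at rate [e]; around
   an exceptional point, a small interval lies inside [U]. Creeping from [a] to
   [b], the total decrease is at most [e * (b - a)] plus the variation of [g]
   over disjoint intervals in [U], which is below [e] by absolute
   continuity. *)
Lemma absolutely_continuous_nondecreasing (a b : R) (g : R -> R) : a <= b ->
  absolutely_continuous_on `[a, b] g ->
  ae_on `[a, b] (fun t => derivable g t 1 /\ 0 <= derive1 g t) -> g a <= g b.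
Proof.
move=> ab gAC [N [mN N0 gN]].
suff main e : 0 < e -> g a <= g b + (e * (b - a) + e).
  apply/ler_addgt0Pr => e e0.
  have ba0 : 0 < b - a + 1 by lra.
  have := main (e / (b - a + 1)) (divr_gt0 e0 ba0).
  rewrite (_ : _ / _ * _ + _ = e)//; field; exact: lt0r_neq0.
move=> e0; have [d d0 dP] := gAC e e0.
have [|U [oU NU Ud]] := lebesgue_regularity_outer mN _ d0.
  by rewrite [X in (X < _)%E](_ : _ = 0%E)// ltry.
have mU : measurable U by exact: open_measurable.
have {}Ud : (mu U < d%:E)%E.
  rewrite (_ : U = (U `\` N) `|` N); last by rewrite setUC setDUK.
  apply: le_lt_trans (measureU2 _ _ _) _ => //; first exact: measurableD.
  by rewrite [X in (_ + X < _)%E](_ : _ = 0%E)// adde0.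
(* On [s, t], g decreases at most at rate e, up to its variation on a chain in U. *)
pose Q s t := exists2 l : seq (R * R), interval_chain U s l t &
  - (e * (t - s)) - \sum_(uv <- l) `|g uv.2 - g uv.1| <= g t - g s.
have [||l lc lg] := @creeping a b Q ab.
- move=> s t w st tw [l lc lg] [l' lc' lg']; exists (l ++ l').
    exact: chain_cat lc lc'.
  rewrite big_cat/=; move: (\sum_(_ <- l) _) (\sum_(_ <- l') _) lg lg' => S S'; lra.
- move=> c cab; have [Nc|Nc] := pselect (N c).
    have /nbhs_ballP[r /= r0 rU] : nbhs c U by apply: open_nbhs_nbhs; split => //; exact: NU.
    exists r => // s t as_ sc ct tb cs tc; exists [:: (s, t)] => /=.
      split => //; first exact: le_trans ct.
      move=> z; rewrite /= in_itv/= => /andP[sz zt]; apply: rU; rewrite /ball/= ltr_norml.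
      by apply/andP; split; lra.
    rewrite big_seq1/=; have : 0 <= e * (t - s) by rewrite mulr_ge0; lra.
    by have := ler_norm (- (g t - g s)); rewrite normrN; lra.
  have [gc gc0] : derivable g c 1 /\ 0 <= derive1 g c.
    by apply: contrapT => no; apply/Nc/gN => /(_ _)h; apply: no; apply: h; rewrite /= in_itv.
  have [r r0 rP] := derivable_slope_lower gc gc0 e0; exists r => // s t as_ sc ct tb cs tc.
  exists [::] => /=; first exact: le_trans ct.
  by rewrite big_nil subr0; exact: rP.
pose u (i : 'I_(size l)) := (nth (0, 0) l i).1.
pose v (i : 'I_(size l)) := (nth (0, 0) l i).2.
have uv i : [/\ a <= u i, u i <= v i, v i <= b & `[u i, v i] `<=` U].
  exact: chain_nth lc _ (ltn_ord i).
have tr : trivIset [set: 'I_(size l)] (fun i => [set` `]u i, v i[]).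
  apply/trivIsetP => i j _ _; wlog ij : i j / (i < j)%N => [wlg|_].
    rewrite neq_ltn => /orP[ij|ij]; first by apply: wlg => //; rewrite neq_ltn ij.
    by rewrite setIC; apply: wlg => //; rewrite neq_ltn ij.
  rewrite -subset0 => z [/=]; rewrite !in_itv/= => /andP[_ zv] /andP[uz _].
  have := @chain_ordered _ _ _ _ lc i j; rewrite ij ltn_ord/= => /(_ isT).
  by rewrite -/(v i) -/(u j) => h; move: (lt_trans uz zv); rewrite ltNge h.
have /dP/(_ tr) : forall i, u i <= v i /\ `[u i, v i] `<=` `[a, b].
  move=> i; have [au uvi vb _] := uv i; split => // z /=; rewrite !in_itv/=.
  by move=> /andP[uz zv]; rewrite (le_trans au uz) (le_trans zv vb).
have h : \sum_(i < size l) (v i - u i) < d.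
  rewrite -lte_fin -disjoint_intervals_measure//; last by move=> i; have [] := uv i.
  apply: le_lt_trans Ud; apply: le_measure; rewrite ?inE//; first exact: bigsetU_measurable.
  rewrite -bigcup_seq => z [i _] /=.
  have [_ _ _ h] := uv i; rewrite in_itv/= => /andP[/ltW uz /ltW zv].
  by apply: h; rewrite /= in_itv/= uz.
move=> /(_ h); have -> : \sum_(i < size l) `|g (v i) - g (u i)| =
    \sum_(uv <- l) `|g uv.2 - g uv.1|.
  by rewrite (big_nth (0, 0)) big_mkord.
move: lg; move: (\sum_(_ <- _) _) => S; lra.
Qed.

End AbsolutelyContinuousMonotone.

(** * Borel versions of Lebesgue measurable functions *)

Section LebesgueVersions.
Context {R : realType}.
Local Notation mu := (@lebesgue_measure R).
Local Notation LT := (caratheodory_type (@wlength R idfun)^*%mu).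
Implicit Types (D : set R) (g h : R -> R).

Lemma Lebesgue_measurable_set (A : set R) : measurable A ->
  (measurable : set (set LT)) A.
Proof. exact: sub_caratheodory. Qed.

Lemma ae_on_imply2 D (P Q S : R -> Prop) : (forall t, D t -> P t -> Q t -> S t) ->
  ae_on D P -> ae_on D Q -> ae_on D S.
Proof.
move=> PQS DP DQ; apply: negligibleS (negligibleU DP DQ) => t /= nS.
have [P'|nP] := pselect (D t -> P t); last by left.
by right => Q'; apply: nS => Dt; apply: PQS; [|exact: P'|exact: Q'].
Qed.

Lemma ae_on_imply D (P Q : R -> Prop) : (forall t, D t -> P t -> Q t) ->
  ae_on D P -> ae_on D Q.
Proof. by move=> PQ DP; apply: (ae_on_imply2 _ DP DP) => t Dt _; exact: PQ. Qed.

Lemma ae_on_countable D (T : countType) (P : T -> R -> Prop) :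
  (forall i, ae_on D (P i)) -> ae_on D (fun t => forall i, P i t).
Proof.
move=> DP.
pose G n := if unpickle n is Some i then [set t | ~ (D t -> P i t)] else set0.
have : mu.-negligible (\bigcup_n G n).
  apply: negligible_bigcup => n; rewrite /G; case: unpickle => [i|]; first exact: DP.
  exact: negligible_set0.
apply: negligibleS => t /= nP; apply: contrapT => no; apply: nP => Dt i.
apply: contrapT => nPi; apply: no; exists (pickle i) => //; rewrite /G pickleK /=.
by apply: contra_not nPi; exact.
Qed.

(** Each Lebesgue measurable superlevel set [q < g], with q rational, is a Borel
   set up to a null set, and g is the supremum of the q below it. *)
Lemma borel_version D g : measurable D -> Lebesgue_measurable_fun D g ->
  exists h, measurable_fun setT h /\ ae_on D (fun t => h t = g t).
Proof.
move=> mD mg; have mDL := Lebesgue_measurable_set mD.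
have /choice[B BP] (q : rat) : exists B, measurable B /\
    ae_on D (fun t => B t <-> ratr q < g t).
  have : (measurable : set (set LT)) (D `&` g @^-1` `]ratr q, +oo[).
    exact: mg.
  rewrite -completed_caratheodory_measurable g_sigma_completed_algebra_genE.
  move=> [B mB [N negN] BN]; exists B; split => //.
  apply: negligibleS negN => t /= nt; apply: contrapT => nNt; apply: nt => Dt.
  have := congr1 (fun A => A t) BN; rewrite /= in_itv/= andbT => E.
  split=> [Bt|qg]; first by (have : B t \/ N t by left); rewrite [_ \/ _]E => -[].
  by (have : D t /\ ratr q < g t by []); rewrite -E => -[].
(* Extended real values occur only on the exceptional null set or outside D. *)
pose h0 t : \bar R := ereal_sup [set (ratr q)%:E | q in [set q : rat | B q t]].
have mh0 : measurable_fun setT h0.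
  apply: (measurability _ (ErealGenOInfty.measurableE R)) => _ [_ [x ->] <-].
  rewrite setTI [X in measurable X](_ : _ =
      \bigcup_(q in [set q : rat | x < ratr q]) B q); last first.
    apply/seteqP; split => t /=.
      rewrite in_itv/= andbT => /ereal_sup_gt[_ [q Bq <-]] xq.
      by exists q.
    move=> [q xq Bq]; rewrite in_itv/= andbT; apply: (@lt_le_trans _ _ (ratr q)%:E).
      by rewrite lte_fin.
    by apply: ereal_sup_ubound; exists q.
  rewrite bigcup_mkcond; apply: bigcupT_measurable_rat => q.
  by case: ifPn => // _; exact: (BP q).1.
exists (fine \o h0); split.
  by apply: measurableT_comp => //; exact: fine_measurable.
have := ae_on_countable (fun q => (BP q).2).
apply: ae_on_imply => t Dt Bt; rewrite /= (_ : h0 t = (g t)%:E)//.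
apply/eqP; rewrite eq_le; apply/andP; split.
  by apply: ge_ereal_sup => _ [q /= /Bt qg <-]; rewrite lee_fin ltW.
rewrite leNgt; apply/negP => hg.
have [x hx xg] : exists2 x : R, (h0 t <= x%:E)%E & x < g t.
  move: hg; case: (h0 t) => [y|//|].
    by rewrite lte_fin => yg; exists y.
  by move=> _; exists (g t - 1); [exact: leNye|lra].
have [q] := rat_in_itvoo xg; rewrite in_itv/= => /andP[xq qg].
have : ((ratr q)%:E <= h0 t)%E by apply: ereal_sup_ubound; exists q => //; apply/Bt.
by move=> /le_trans/(_ hx); rewrite lee_fin leNgt xq.
Qed.

End LebesgueVersions.

(** * Superposition with Caratheodory functions *)

Section Superposition.
Context {R : realType}.
Local Notation mu := (@lebesgue_measure R).
Local Notation cmu := (@completed_lebesgue_measure R).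
Local Notation LT := (caratheodory_type (@wlength R idfun)^*%mu).
Implicit Types (D : set R) (g h u v psi : R -> R).

Lemma Borel_Lebesgue_measurable D g : measurable D -> measurable_fun D g ->
  Lebesgue_measurable_fun D g.
Proof. by move=> mD mg _ Y mY; apply: Lebesgue_measurable_set; exact: mg. Qed.

Lemma Lebesgue_measurable_funS D D' g : measurable D' -> D `<=` D' ->
  Lebesgue_measurable_fun D' g -> Lebesgue_measurable_fun D g.
Proof.
by move=> mD'; apply: (@measurable_funS _ _ LT R D'); exact: Lebesgue_measurable_set.
Qed.

Lemma Lebesgue_negligible_measurable (A : set R) : mu.-negligible A ->
  (measurable : set (set LT)) A.
Proof.
move=> [N [mN N0 AN]]; apply: completed_lebesgue_measure_is_complete.
by exists N; split; [exact: Lebesgue_measurable_set|exact: N0|exact: AN].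
Qed.

(** A discretization with countably many values, constant on half-open
   intervals of length 1 / (n + 1). *)
Definition grid_floor (n : nat) (x : R) : R :=
  (Num.floor (x * n.+1%:R))%:~R / n.+1%:R.

Lemma grid_floor_cvg x : grid_floor n x @[n --> \oo] --> x.
Proof.
apply: (@cvg_harmonic_bound _ _ _ 1) => n; rewrite mul1r.
have n0 : 0 < n.+1%:R :> R by rewrite ltr0n.
have /andP[h1 h2] := floor_itv (x * n.+1%:R).
rewrite -(ler_pM2r n0) mulVf ?gt_eqF// -[X in _ * X]gtr0_norm// -normrM.
rewrite mulrBl divfK ?gt_eqF// ler_norml; move: h2; rewrite intrD; lra.
Qed.

Lemma measurable_discretized (f : R -> R -> R -> R) u v D n : measurable D ->
  (forall x y, Lebesgue_measurable_fun D (fun t => f t x y)) ->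
  Lebesgue_measurable_fun D u -> Lebesgue_measurable_fun D v ->
  Lebesgue_measurable_fun D (fun t => f t (grid_floor n (u t)) (grid_floor n (v t))).
Proof.
move=> mD mf mu_ mv mDL Y mY; have n0 : 0 < n.+1%:R :> R by rewrite ltr0n.
pose cell (w : R -> R) (i : int) := D `&`
  w @^-1` [set x | Num.floor (x * n.+1%:R) = i].
have mcell w i : Lebesgue_measurable_fun D w -> (measurable : set (set LT)) (cell w i).
  move=> mw; apply: mw => //.
  rewrite (_ : [set _ | _] = `[i%:~R / n.+1%:R, (i + 1)%:~R / n.+1%:R[%classic) //.
  apply/seteqP; split => x /=; rewrite in_itv/= ler_pdivrMr// ltr_pdivlMr//.
    by move=> <-; exact: floor_itv.
  by move=> h; apply: floor_def.
pose c (i : int) : R := i%:~R / n.+1%:R.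
rewrite (_ : _ `&` _ = \bigcup_(ij : int * int)
    (cell u ij.1 `&` cell v ij.2 `&` (D `&` (fun t => f t (c ij.1) (c ij.2)) @^-1` Y))).
  apply: countable_bigcupT_measurable; first exact: countableP.
  move=> [i j]; apply: measurableI; last exact: mf.
  by apply: measurableI; exact: mcell.
apply/seteqP; split => t /=.
  by move=> [Dt Yt]; exists (Num.floor (u t * n.+1%:R), Num.floor (v t * n.+1%:R)).
by move=> [[i j] _ /= [[[_ ui] [_ vj]] [Dt]]]; rewrite /grid_floor ui vj.
Qed.

(** For discretized arguments only countably many of the functions f(., x, y)
   occur. Their limit is f(., u, v) at every t where f(t, ., .) is continuous,
   and the remaining null set is harmless by completeness. *)
Lemma measurable_superposition (f : R -> R -> R -> R) u v D : measurable D ->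
  (forall x y, Lebesgue_measurable_fun D (fun t => f t x y)) ->
  ae_on D (fun t => continuous (fun p : R * R => f t p.1 p.2)) ->
  Lebesgue_measurable_fun D u -> Lebesgue_measurable_fun D v ->
  Lebesgue_measurable_fun D (fun t => f t (u t) (v t)).
Proof.
move=> mD mf [N [mN N0 fN]] mu_ mv.
have mDL := Lebesgue_measurable_set mD; have mNL := Lebesgue_measurable_set mN.
(* N contains the t at which f(t, ., .) is discontinuous. *)
have DE : D = (D `\` N) `|` (D `&` N) by rewrite setUC setUIDK.
rewrite /Lebesgue_measurable_fun [X in measurable_fun X _]DE.
apply/measurable_funU; [exact: measurableD|exact: measurableI|split].
  apply: (@measurable_fun_cvg _ LT R _
    (fun n t => f t (grid_floor n (u t)) (grid_floor n (v t)))).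
    move=> n; apply: (Lebesgue_measurable_funS mD); first exact: subDsetl.
    exact: (measurable_discretized n mD mf mu_ mv).
  move=> t [Dt Nt]; have ft : continuous (fun p : R * R => f t p.1 p.2).
    by apply: contrapT => nft; apply/Nt/fN => /(_ Dt).
  have uv : (grid_floor n (u t), grid_floor n (v t)) @[n --> \oo] --> (u t, v t).
    exact: (cvg_pair (@grid_floor_cvg (u t)) (@grid_floor_cvg (v t))).
  exact: cvg_comp uv (ft (u t, v t)).
move=> _ Y mY; apply: Lebesgue_negligible_measurable; exists N; split => //.
by move=> t [[]].
Qed.

(** Clipping a Borel version makes the bound hold everywhere without changing
   the almost everywhere class. *)
Lemma dominated_version D g psi : measurable D -> Lebesgue_measurable_fun D g ->
  measurable_fun setT psi -> (forall t, 0 <= psi t) ->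
  ae_on D (fun t => `|g t| <= psi t) ->
  exists h : R -> R, [/\ measurable_fun setT h, forall t, `|h t| <= psi t &
    ae_on D (fun t => h t = g t)].
Proof.
move=> mD mg mpsi psi0 gpsi; have [h [mh hg]] := borel_version mD mg.
exists ((fun t => - psi t) \max (psi \min h)); split.
- apply: measurable_maxr; first exact: measurableT_comp.
  exact: measurable_minr.
- move=> t /=; have := psi0 t; rewrite ler_norml ge_max le_max ge_min !lexx/= => p0.
  by rewrite andbT; lra.
- apply: ae_on_imply2 hg gpsi => t Dt htgt; rewrite /= htgt ler_norml => /andP[g1 g2].
  by rewrite min_r// max_r.
Qed.

(** The identity from the Lebesgue to the Borel sigma-algebra pushes the
   completed measure forward to Lebesgue measure, so that integrability
   transfers to the Borel version of psi. *)
Lemma Borel_dominant D psi : measurable D -> Lebesgue_integrable D psi ->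
  exists p : R -> R, [/\ measurable_fun setT p, forall t, 0 <= p t,
    (forall t, ~ D t -> p t = 0) /\ mu.-integrable setT (EFin \o p) & ae_on D (fun t => psi t <= p t)].
Proof.
move=> mD /integrableP[mpsi ipsi].
have mDL := Lebesgue_measurable_set mD.
have [h [mh hpsi]] : exists h, measurable_fun setT h /\ ae_on D (fun t => h t = psi t).
  by apply: borel_version => //; exact/measurable_EFinP.
pose p := (fun t => `|h t|) \_ D.
have mp : measurable_fun setT p.
  apply/(measurable_restrictT _ mD); apply: measurable_funTS.
  exact: measurableT_comp.
exists p; split => //.
- by move=> t; rewrite /p patchE; case: ifP.
- split; first by move=> t nDt; rewrite /p patchE memNset.
  apply/integrableP; split; first exact/measurable_EFinP.
  apply: le_lt_trans ipsi.
  rewrite [X in (X <= _)%E](_ : _ = \int[mu]_(t in D) `|h t|%:E)%E; last first.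
    rewrite [RHS]integral_mkcond; apply: eq_integral => t _.
    rewrite /= /p !patchE; case: ifP => _; by rewrite ?normr0// normr_id.
  have mid : @measurable_fun _ _ LT R setT idfun.
    by move=> _ Y mY; rewrite setTI; exact: Lebesgue_measurable_set.
  have -> : (\int[mu]_(t in D) `|h t|%:E = \int[cmu]_(t in D) `|h t|%:E)%E.
    apply: (@ge0_integral_pushforward _ _ LT (measurableTypeR R) R idfun mid cmu D
      (fun t => `|h t|%:E)) => //.
    by apply/measurable_EFinP; apply: measurable_funTS; exact: measurableT_comp.
  rewrite le_eqVlt; apply/orP; left; apply/eqP.
  apply: ge0_ae_eq_integral => //.
  + apply/measurable_EFinP; apply: Borel_Lebesgue_measurable => //.
    by apply: measurable_funTS; exact: measurableT_comp.
  + exact: measurableT_comp.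
  + move: hpsi => [N [mN N0 hN]]; exists N; split => //.
      exact: Lebesgue_measurable_set.
    move=> t nt; apply: hN => ht; apply: nt => Dt /=.
    by rewrite ht.
- apply: ae_on_imply hpsi => t Dt; rewrite /p patchE mem_set// => <-.
  exact: ler_norm.
Qed.

End Superposition.

(** * Indefinite integrals of dominated functions *)

Section IndefiniteIntegral.
Context {R : realType}.
Local Notation mu := (@lebesgue_measure R).

Definition indefinite_integral (h : R -> R) (t : R) : R := \int[mu]_(x in `]-oo, t]) h x.

Definition dominated_by (psi h : R -> R) : Prop :=
  measurable_fun setT h /\ forall t, `|h t| <= psi t.

Variable psi : R -> R.
Hypothesis mpsi : measurable_fun setT psi.
Hypothesis psi0 : forall t, 0 <= psi t.
Hypothesis ipsi : mu.-integrable setT (EFin \o psi).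

Lemma dominated_self : dominated_by psi psi.
Proof. by split => // t; rewrite ger0_norm. Qed.

Lemma dominated_integrable h (A : set R) : dominated_by psi h -> measurable A ->
  mu.-integrable A (EFin \o h).
Proof.
move=> [mh hpsi] mA; apply: (@integrableS _ _ _ _ setT) => //.
apply: le_integrable ipsi => //; first exact/measurable_EFinP.
by move=> t _; rewrite /= lee_fin (ger0_norm (psi0 t)).
Qed.

Lemma indefB h s t : dominated_by psi h -> s <= t ->
  indefinite_integral h t - indefinite_integral h s = \int[mu]_(x in `]s, t]) h x.
Proof.
move=> hd st; rewrite /indefinite_integral Rintegral_itvB//.
exact: dominated_integrable.
Qed.

Lemma indefinite_integral_dominated h s t : dominated_by psi h -> s <= t ->
  `|indefinite_integral h t - indefinite_integral h s| <= indefinite_integral psi t - indefinite_integral psi s.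
Proof.
move=> hd st; rewrite !indefB//; last exact: dominated_self.
apply: le_trans (le_normr_Rintegral _ _) _ => //.
  exact: dominated_integrable.
apply: le_Rintegral => //; last by move=> x _; exact: hd.2.
  apply: (@dominated_integrable (fun x => `|h x|)) => //.
  split; last by move=> x; rewrite normr_id; exact: hd.2.
  by apply: measurableT_comp => //; exact: hd.1.
exact: (dominated_integrable dominated_self).
Qed.

(** Absolute continuity of the integral with respect to the measure, applied to
   a finite union of disjoint intervals. *)
Lemma indefinite_integral_small e : 0 < e -> exists2 d, 0 < d &
  forall n (u v : 'I_n -> R), (forall i, u i <= v i) ->
    trivIset setT (fun i => [set` `]u i, v i[]) ->
    \sum_(i < n) (v i - u i) < d -> \sum_(i < n) (indefinite_integral psi (v i) - indefinite_integral psi (u i)) < e.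
Proof.
move=> e0; have [d [d0 dP]] := integral_normr_continuous ipsi e0; exists d => //.
move=> n u v uv tr uvd.
pose A := \big[setU/set0]_(i < n) [set` `]u i, v i[].
have mA : measurable A by exact: bigsetU_measurable.
have muA : (mu A < d%:E)%E by rewrite /A disjoint_intervals_measure// lte_fin.
have := dP A mA muA.
congr (_ < _); rewrite /Rintegral.
under eq_integral do rewrite ger0_norm//.
rewrite ge0_integral_bigsetU//=.
- rewrite -sum_fine => [|i _]; last first.
    by apply: integrable_fin_num => //; exact: (dominated_integrable dominated_self).
  apply: eq_bigr => i _; rewrite indefB//; last exact: dominated_self.
  rewrite -Rintegral_itv_bndo_bndc//.
  exact: (dominated_integrable dominated_self).
- exact: index_enum_uniq.
- exact: sub_trivIset tr.
- by apply: measurable_funTS; exact/measurable_EFinP.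
- by move=> x _; rewrite lee_fin.
Qed.

Lemma dominated_increments_AC (J : set R) (x : R -> R) :
  (forall s t, J s -> J t -> s <= t -> `|x t - x s| <= indefinite_integral psi t - indefinite_integral psi s) ->
  absolutely_continuous_on J x.
Proof.
move=> xpsi e e0; have [d d0 dP] := indefinite_integral_small e0; exists d => //.
move=> n u v uvJ tr uvd.
apply: le_lt_trans (dP n u v (fun i => (uvJ i).1) tr uvd).
apply: ler_sum => i _; have [uv sub] := uvJ i.
by apply: xpsi => //; apply: sub; rewrite /= in_itv/= lexx ?uv.
Qed.

Lemma indefinite_integral_uniform e : 0 < e -> exists2 d, 0 < d &
  forall s t, s <= t -> t - s < d -> indefinite_integral psi t - indefinite_integral psi s < e.
Proof.
move=> e0; have [d d0 dP] := indefinite_integral_small e0; exists d => // s t st std.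
(* A single interval. *)
have := dP 1%N (fun=> s) (fun=> t) (fun=> st); rewrite !big_ord1; apply => //.
by move=> i j _ _ _; rewrite !ord1.
Qed.

Lemma indefinite_integral_derivable h : dominated_by psi h ->
  ae_on setT (fun t => derivable (indefinite_integral h) t 1 /\ derive1 (indefinite_integral h) t = h t).
Proof.
move=> hd; have := @FTC1Ny R h _ _.
have h1 y : mu.-integrable `]-oo, y] (EFin \o h) by exact: dominated_integrable.
have h2 : locally_integrable [set: R] h.
  by apply: open_integrable_locally; [exact: openT|exact: dominated_integrable].
move=> /(_ h1 h2)/=; apply: negligibleS => t /= nt; apply: contra_not nt => + _.
exact.
Qed.

Lemma indefinite_integral_cvg (u : nat -> R -> R) h : (forall n, dominated_by psi (u n)) ->
  dominated_by psi h -> ae_on setT (fun t => u n t @[n --> \oo] --> h t) ->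
  forall t, indefinite_integral (u n) t @[n --> \oo] --> indefinite_integral h t.
Proof.
move=> ud hd uh t.
have [|||||_ _] := @dominated_convergence _ _ R mu `]-oo, t]%classic (measurable_itv _)
  (fun n => EFin \o u n) (EFin \o h) (EFin \o psi).
- by move=> n; apply: measurable_funTS; apply/measurable_EFinP; exact: (ud n).1.
- by apply: measurable_funTS; apply/measurable_EFinP; exact: hd.1.
- apply: negligibleS uh => x /= nx; apply: contra_not nx => ux _.
  by apply: cvg_EFin; [exact: nearW|exact: ux].
- exact: (dominated_integrable dominated_self).
- by apply: aeW => x n _; rewrite /= lee_fin; exact: (ud n).2.
have fin : (\int[mu]_(x in `]-oo, t]) (h x)%:E)%E \is a fin_num.
  by apply: integrable_fin_num => //; exact: (dominated_integrable hd).
by rewrite -(fineK fin) => /fine_cvg.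
Qed.

End IndefiniteIntegral.

(** * Continuous and absolutely continuous functions on segments *)

Section ContinuousOnSegments.
Context {R : realType}.
Implicit Types (A B : R) (x y z : R -> R).

(** Heine-Cantor, by contradiction: the points of arbitrarily close pairs with
   separated images would cluster at a point of discontinuity. *)
Lemma Cspace_equicontinuous A B x : Cspace `[A, B] x ->
  equicontinuous_family A B [set x].
Proof.
move=> /CspaceP[xc _] e e0; apply: contrapT => no.
have /choice[s /choice[t st]] n : exists s t, [/\ A <= s <= B, A <= t <= B,
    `|s - t| < n.+1%:R^-1 & e < `|x s - x t|].
  apply: contrapT => nst; apply: no; exists n.+1%:R^-1; first by rewrite invr_gt0.
  move=> _ -> s t sAB tAB std; rewrite leNgt; apply/negP => xst.
  by apply: nst; exists s, t.
(* Numbers are viewed as functions on a one-point set. *)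
have [||c0 [phi cphi]] := @uniform_subsequence R unit setT (fun n _ => s n) (`|A| + `|B|).
- move=> n _ _; have [/andP[As sB] _ _ _] := st n.
  move: As sB (ler_norm A) (ler_norm (- A)) (ler_norm B) (ler_norm (- B)).
  rewrite !normrN => As sB; move: (normr_ge0 A) (normr_ge0 B); rewrite ler_norml; lra.
- by move=> d d0; exists [:: tt] => // -[] _; exists tt => // n; rewrite subrr normr0 ltW.
pose c := c0 tt.
have sc : s (phi n) @[n --> \oo] --> c.
  by apply: (@cvg_harmonic_bound _ _ _ 1) => n; rewrite mul1r; exact: (cphi n).2.
have cAB : A <= c <= B.
  rewrite -(cvg_lim (@Rhausdorff R) sc); apply/andP; split.
    by apply: limr_ge; [apply/cvg_ex; exists c|apply: nearW => n; case: (st (phi n)) => /andP[]].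
  by apply: limr_le; [apply/cvg_ex; exists c|apply: nearW => n; case: (st (phi n)) => /andP[]].
have e2 : 0 < e / 2 by lra.
have [d d0 dP] := xc c cAB _ e2.
have d4 : 0 < d / 4 by lra.
have [N NP] := harmonic_le d4.
have [sAB tAB std xst] := st (phi N).
have h1 := le_trans ((cphi N).2 tt Logic.I) (NP N (leqnn N)).
have h2 := le_trans (ltW std) (NP (phi N) (cphi N).1).
have xs : `|x (s (phi N)) - x c| <= e / 2.
  by apply: dP => //; apply: le_lt_trans h1 _; lra.
have xt : `|x (t (phi N)) - x c| <= e / 2.
  apply: dP => //; move: h1 h2; rewrite -/c !ler_norml ltr_norml => h1 h2.
  by apply/andP; split; lra.
move: xst; rewrite ltNge => /negP; apply.
by move: xs xt; rewrite !ler_norml; lra.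
Qed.

Lemma Cspace_bounded A B x : Cspace `[A, B] x ->
  exists M, forall t, A <= t <= B -> `|x t| <= M.
Proof.
move=> /Cspace_equicontinuous/(_ 1 ltr01)[d d0 dP].
have [s sAB sd] := segment_net A B d0; exists (\sum_(i <- s) `|x i| + 1) => t tAB.
have [i is_ ti] := sd t tAB.
have xi : `|x i| <= \sum_(i <- s) `|x i|.
  by rewrite (big_rem i)//= lerDl sumr_ge0.
have := dP x erefl t i tAB (sAB i is_) ti; move: xi.
by move: (\sum_(_ <- _) _) => S; rewrite !ler_norml; lra.
Qed.

Lemma continuous_on_Cspace_cvg (J : set R) (Phi : (R -> R) -> R) (u : nat -> R -> R) x :
  continuous_on_Cspace J Phi -> (forall n, Cspace J (u n)) -> Cspace J x ->
  uniformly_cvg J u x -> Phi (u n) @[n --> \oo] --> Phi x.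
Proof.
move=> /subspace_continuousP Phic uC xC ux; apply/cvgrPdist_le => e e0.
have /cvgrPdist_le/(_ e e0) := Phic x xC.
rewrite near_withinE => /uniform_nbhs[E [entE EP]].
move: entE; rewrite -entourage_from_ballE => -[r /= r0 rE].
have r2 : 0 < r / 2 by lra.
have [N NP] := ux _ r2; exists N => // n /= /NP un.
apply: EP (uC n) => /= t Jt; apply: rE => /=; rewrite /ball/= distrC.
by apply: le_lt_trans (un t Jt) _; lra.
Qed.

Lemma Cspace_max A B x y : Cspace `[A, B] x -> Cspace `[A, B] y ->
  Cspace `[A, B] (x \max y).
Proof.
move=> [xc x0] [yc y0]; split; last by move=> t nt; rewrite /= x0// y0// maxxx.
exact: (@max_fun_continuous _ (subspace `[A, B]) R x y).
Qed.

Lemma Cspace_min A B x y : Cspace `[A, B] x -> Cspace `[A, B] y ->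
  Cspace `[A, B] (x \min y).
Proof.
move=> [xc x0] [yc y0]; split; last by move=> t nt; rewrite /= x0// y0// minxx.
exact: (@min_fun_continuous _ (subspace `[A, B]) R x y).
Qed.

Lemma Cspace_cvg A B x (s : nat -> R) t : Cspace `[A, B] x ->
  (forall n, A <= s n <= B) -> A <= t <= B -> s n @[n --> \oo] --> t ->
  x (s n) @[n --> \oo] --> x t.
Proof.
move=> /CspaceP[xc _] sAB tAB st; apply/cvgrPdist_le => e e0.
have [d d0 dP] := xc t tAB e e0.
have d2 : 0 < d / 2 by lra.
have /cvgrPdist_le/(_ _ d2) := st; apply: filterS => n sn.
rewrite distrC; apply: dP => //; rewrite distrC; apply: le_lt_trans sn _; lra.
Qed.

Lemma Cspace_measurable A B x : Cspace `[A, B] x -> measurable_fun setT x.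
Proof.
move=> [xc x0]; rewrite (_ : x = x \_ `[A, B]%classic).
  apply: (iffLR (measurable_restrictT _ _)) => //.
  by apply: subspace_continuous_measurable_fun => //; exact: xc.
apply/funext => t; rewrite patchE; case: ifPn => //.
by rewrite notin_setE => /x0.
Qed.

Lemma absolutely_continuousB (J : set R) x y :
  absolutely_continuous_on J x -> absolutely_continuous_on J y ->
  absolutely_continuous_on J (x \- y).
Proof.
move=> xAC yAC e e0; have e2 : 0 < e / 2 by lra.
have [d d0 dP] := xAC _ e2; have [d' d'0 d'P] := yAC _ e2.
exists (Num.min d d'); first by rewrite lt_min d0.
move=> n u v uvJ tr; rewrite lt_min => /andP[/(dP n u v uvJ tr) h1 /(d'P n u v uvJ tr) h2].
rewrite [ltRHS](splitr e); apply: le_lt_trans (ltrD h1 h2).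
rewrite -big_split/=; apply: ler_sum => i _.
rewrite /= (_ : x _ - _ - _ = (x (v i) - x (u i)) - (y (v i) - y (u i))); last by ring.
exact: ler_normB.
Qed.

Lemma absolutely_continuousS (J K : set R) x : K `<=` J ->
  absolutely_continuous_on J x -> absolutely_continuous_on K x.
Proof.
move=> KJ xAC e e0; have [d d0 dP] := xAC e e0; exists d => // n u v uvK.
apply: dP => i; have [uv h] := uvK i; split => //.
exact: subset_trans KJ.
Qed.

Lemma absolutely_continuous_uniform (J : set R) x : absolutely_continuous_on J x ->
  forall e, 0 < e -> exists2 d, 0 < d & forall s t, s <= t -> `[s, t] `<=` J ->
    t - s < d -> `|x t - x s| < e.
Proof.
move=> xAC e e0; have [d d0 dP] := xAC e e0; exists d => // s t st sub std.
have := dP 1%N (fun=> s) (fun=> t) (fun=> conj st sub); rewrite !big_ord1; apply => //.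
by move=> i j _ _ _; rewrite !ord1.
Qed.

Lemma ae_onS (J K : set R) (P : R -> Prop) : K `<=` J -> ae_on J P -> ae_on K P.
Proof.
move=> KJ; apply: negligibleS => t /= nP; apply: contra_not nP => JP Kt.
exact/JP/KJ.
Qed.

(** To the right of the last point before [t1] where z <= y, the difference y - z
   is nondecreasing, hence stays nonnegative. *)
Lemma barrier A B y z : absolutely_continuous_on `[A, B] y ->
  absolutely_continuous_on `[A, B] z -> z A <= y A ->
  ae_on `[A, B] (fun t => [/\ derivable y t 1, derivable z t 1 &
    y t < z t -> derive1 z t <= derive1 y t]) ->
  forall t, A <= t <= B -> z t <= y t.
Proof.
move=> yAC zAC zyA yz t1 /andP[At1 t1B]; rewrite leNgt; apply/negP => yzt1.
have gAC := absolutely_continuousB yAC zAC; set g := y \- z in gAC.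
pose S := [set s | A <= s <= t1 /\ 0 <= g s].
have SA : S A by rewrite /S/= lexx At1 /g/= subr_ge0.
have Sub : has_ubound S by exists t1 => s [/andP[]].
set a := sup S.
have Aa : A <= a by apply: ub_le_sup.
have at1 : a <= t1 by apply: ge_sup; [exists A|move=> s [/andP[]]].
have ga0 : 0 <= g a.
  rewrite leNgt; apply/negP => ga.
  have gNa : 0 < - g a by rewrite oppr_gt0.
  have [d d0 dP] := absolutely_continuous_uniform gAC gNa.
  have [s [/andP[As st1] gs] as_] : exists2 s, S s & a - d < s.
    by apply: sup_adherent => //; split; [exists A|].
  have sa : s <= a by apply: ub_le_sup => //; split => //; rewrite As.
  have := dP s a sa; rewrite ltrBlDr -ltrBlDl => /(_ _ as_); rewrite ltr_norml.
  have sub : `[s, a] `<=` `[A, B].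
    by move=> w /=; rewrite !in_itv/= => /andP[sw wa]; apply/andP; split; lra.
  by move=> /(_ sub)/andP[+ _]; lra.
have gpos s : a < s -> s <= t1 -> y s < z s.
  move=> as_ st1; rewrite ltNge; apply/negP => zs; have As := le_trans Aa (ltW as_).
  move: as_; rewrite ltNge => /negP; apply.
  by apply: ub_le_sup => //; split; [rewrite As|rewrite /g/= subr_ge0].
have sub : `[a, t1] `<=` `[A, B].
  by move=> w /=; rewrite !in_itv/= => /andP[sw wa]; apply/andP; split; lra.
have : g a <= g t1.
  apply: absolutely_continuous_nondecreasing => //.
    exact: absolutely_continuousS gAC.
  (* At a itself y < z may fail, but a single point is negligible. *)
  have na : ae_on `[a, t1] (fun t => t != a).
    exists [set a]; split => //; first exact: lebesgue_measure_set1.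
    move=> t /= nt; apply: contrapT => ta; apply: nt => _; exact/eqP.
  apply: ae_on_imply2 na (ae_onS sub yz) => t /=; rewrite in_itv/= => /andP[at_ tt1] ta.
  move=> [dy dz /(_ (gpos t _ tt1))]; rewrite lt_neqAle eq_sym ta at_ => /(_ isT) zy.
  split; first exact: derivableB.
  by rewrite derive1E deriveB// -!derive1E subr_ge0.
by move: yzt1 ga0; rewrite /g/=; lra.
Qed.

End ContinuousOnSegments.

(** * The functional differential problem as a fixed point problem *)

Lemma Itotal_itv (R : realType) (t0 L r : R) : 0 <= L -> 0 <= r ->
  Itotal t0 L r = `[t0 - r, t0 + L]%classic.
Proof.
move=> L0 r0.
apply/seteqP; split => t; rewrite /Itotal /Iminus /Izero /= !in_itv/=.
  by case=> /andP[h1 h2]; apply/andP; split; lra.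
move=> /andP[h1 h2]; have [h|/ltW h] := leP t t0; [left|right].
  by rewrite h1.
by rewrite h.
Qed.

Section FunctionalProblem.
Context {R : realType}.
Variables (t0 L r : R) (f : R -> R -> R -> R) (tau : R -> (R -> R) -> R).
Variables (Lambda : (R -> R) -> R) (k alpha beta p : R -> R) (E : R -> set R).
Local Notation J := (`[t0 - r, t0 + L]%classic : set R).
Local Notation I0 := (`[t0, t0 + L]%classic : set R).

Hypothesis L_gt0 : 0 < L.
Hypothesis r_ge0 : 0 <= r.
Hypothesis f_measurable : forall x y, Lebesgue_measurable_fun I0 (fun t => f t x y).
Hypothesis f_continuous :
  ae_on I0 (fun t => continuous (fun q : R * R => f t q.1 q.2)).
Hypothesis tau_range : forall t gamma, I0 t -> Cspace J gamma -> J (tau t gamma).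
Hypothesis tau_measurable : forall gamma, Cspace J gamma ->
  Lebesgue_measurable_fun I0 (fun t => tau t gamma).
Hypothesis tau_continuous : ae_on I0 (fun t => continuous_on_Cspace J (tau t)).
Hypothesis k_continuous : Cspace `[t0 - r, t0] k.
Hypothesis Lambda_continuous : continuous_on_Cspace J Lambda.
Hypothesis alphaC : Cspace J alpha.
Hypothesis betaC : Cspace J beta.
Hypothesis alpha_le_beta : le_on J alpha beta.
Hypothesis alpha_AC : absolutely_continuous_on I0 alpha.
Hypothesis beta_AC : absolutely_continuous_on I0 beta.
Hypothesis history : forall gamma, order_interval J alpha beta gamma ->
  forall t, t0 - r <= t <= t0 -> alpha t <= Lambda gamma + k t <= beta t.
Hypothesis E_delayed : forall t gamma, I0 t -> order_interval J alpha beta gamma ->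
  E t (gamma (tau t gamma)).
Hypothesis alpha_lower : ae_on I0 (fun t => derivable alpha t 1 /\
  forall xi, E t xi -> derive1 alpha t <= f t (alpha t) xi).
Hypothesis beta_upper : ae_on I0 (fun t => derivable beta t 1 /\
  forall xi, E t xi -> f t (beta t) xi <= derive1 beta t).
Hypothesis p_measurable : measurable_fun setT p.
Hypothesis p_ge0 : forall t, 0 <= p t.
Hypothesis p_off : forall t, ~ I0 t -> p t = 0.
Hypothesis p_integrable : (@lebesgue_measure R).-integrable setT (EFin \o p).
Hypothesis f_dominated : ae_on I0 (fun t => forall x y,
  alpha t <= x <= beta t -> E t y -> `|f t x y| <= p t).

Definition truncate (gamma : R -> R) : R -> R := alpha \max (gamma \min beta).

Let JE t : J t <-> t0 - r <= t <= t0 + L.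
Proof. by rewrite /= in_itv. Qed.

Let I0E t : I0 t <-> t0 <= t <= t0 + L.
Proof. by rewrite /= in_itv. Qed.

Let I0J : I0 `<=` J.
Proof.
move=> t /I0E/andP[h1 h2]; apply/JE/andP; split => //.
by apply: le_trans h1; rewrite gerBl.
Qed.

Lemma truncate_interval gamma : Cspace J gamma ->
  order_interval J alpha beta (truncate gamma).
Proof.
move=> gC; split; first exact: Cspace_max (Cspace_min gC betaC).
- by move=> t Jt; rewrite /truncate/= le_max lexx.
- by move=> t Jt; rewrite /truncate/= ge_max alpha_le_beta// ge_min lexx orbT.
Qed.

Lemma truncate_id gamma : order_interval J alpha beta gamma -> truncate gamma = gamma.
Proof.
move=> [gC ag gb]; apply/funext => t; rewrite /truncate/=.
have [Jt|nJt] := pselect (J t); first by rewrite min_l ?gb// max_r// ag.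
by rewrite alphaC.2// betaC.2// gC.2// minxx maxxx.
Qed.

Lemma truncate_dist gamma gamma' t :
  `|truncate gamma t - truncate gamma' t| <= `|gamma t - gamma' t|.
Proof.
rewrite /truncate/=.
move: (gamma t) (gamma' t) (alpha t) (beta t) => g g' a b.
have lip (op : R -> R) : (forall u v, v <= u -> 0 <= op u - op v <= u - v) ->
    forall u v, `|op u - op v| <= `|u - v|.
  move=> opP u v; have [uv|/ltW vu] := leP v u.
    by have /andP[h1 h2] := opP u v uv; rewrite (ger0_norm h1) ger0_norm ?subr_ge0.
  have /andP[h1 h2] := opP v u vu; rewrite distrC [leRHS]distrC.
  by rewrite (ger0_norm h1) ger0_norm ?subr_ge0.
apply: (@le_trans _ _ `|Num.min g b - Num.min g' b|).
  apply: (lip (Num.max a)) => u v vu; rewrite /Num.max.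
  by case: (ltP a u) => ?; case: (ltP a v) => ?; apply/andP; split; lra.
apply: (lip (Num.min^~ b)) => u v vu; rewrite /Num.min.
by case: (ltP u b) => ?; case: (ltP v b) => ?; apply/andP; split; lra.
Qed.

Lemma truncate_cvg u x : uniformly_cvg J u x ->
  uniformly_cvg J (fun n => truncate (u n)) (truncate x).
Proof.
move=> ux e e0; have [N NP] := ux e e0; exists N => n Nn t Jt.
exact: le_trans (truncate_dist _ _ _) (NP n Nn t Jt).
Qed.

(** Also [tau] receives the truncated function, so that the delayed value lies
   in [E t]. *)
Definition rhs (gamma : R -> R) (t : R) : R :=
  f t (truncate gamma t) (truncate gamma (tau t (truncate gamma))).

Lemma rhs_measurable gamma : Cspace J gamma -> Lebesgue_measurable_fun I0 (rhs gamma).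
Proof.
move=> /truncate_interval[gC _ _]; apply: measurable_superposition => //.
  apply: Borel_Lebesgue_measurable => //; apply: measurable_funTS.
  exact: Cspace_measurable gC.
apply: (@measurable_comp _ _ _ _ _ _ setT) => //.
  exact: Cspace_measurable gC.
exact: tau_measurable.
Qed.

Lemma rhs_dominated gamma : Cspace J gamma -> ae_on I0 (fun t => `|rhs gamma t| <= p t).
Proof.
move=> gC; have tr := truncate_interval gC; apply: ae_on_imply f_dominated => t It; apply.
  by case: tr => _ a b; rewrite a ?b//; exact: I0J.
exact: E_delayed.
Qed.

Lemma rhs_cvg u x : (forall n, Cspace J (u n)) -> Cspace J x -> uniformly_cvg J u x ->
  ae_on I0 (fun t => rhs (u n) t @[n --> \oo] --> rhs x t).
Proof.
move=> uC xC ux; apply: ae_on_imply2 f_continuous tau_continuous => t It ft taut.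
have tuC n : Cspace J (truncate (u n)) by have [] := truncate_interval (uC n).
have txC : Cspace J (truncate x) by have [] := truncate_interval xC.
have tux := truncate_cvg ux.
have tau_cvg := continuous_on_Cspace_cvg taut tuC txC tux.
have tauJ n := (iffLR (JE _)) (tau_range It (tuC n)).
have taux := (iffLR (JE _)) (tau_range It txC).
have xtau := Cspace_cvg txC tauJ taux tau_cvg.
have pt : truncate (u n) t @[n --> \oo] --> truncate x t.
  apply/cvgrPdist_le => e e0; have [N NP] := tux e e0; exists N => // n /= Nn.
  by rewrite distrC; apply: NP => //; exact: I0J.
have ptau : truncate (u n) (tau t (truncate (u n))) @[n --> \oo] -->
    truncate x (tau t (truncate x)).
  apply/cvgrPdist_le => e e0; have e2 : 0 < e / 2 by lra.
  have [N NP] := tux _ e2; have /cvgrPdist_le/(_ _ e2)[N' _ NP'] := xtau.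
  exists (maxn N N') => // n /=; rewrite geq_max => /andP[Nn /NP' h'].
  have h := NP n Nn _ (tau_range It (tuC n)).
  move: h h'; rewrite !ler_norml /=; lra.
have puv : (truncate (u n) t, truncate (u n) (tau t (truncate (u n)))) @[n --> \oo]
  --> (truncate x t, truncate x (tau t (truncate x))) by exact: cvg_pair pt ptau.
exact: cvg_comp puv (ft (truncate x t, truncate x (tau t (truncate x)))).
Qed.

Lemma exists_rhs_version : exists G : (R -> R) -> R -> R, forall gamma, Cspace J gamma ->
  dominated_by p (G gamma) /\ ae_on I0 (fun t => G gamma t = rhs gamma t).
Proof.
suff /choice[G GP] : forall gamma, exists h : R -> R, Cspace J gamma ->
  dominated_by p h /\ ae_on I0 (fun t => h t = rhs gamma t) by exists G.
move=> gamma.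
have [gC|nC] := pselect (Cspace J gamma); last by exists gamma.
have [h [mh hp hE]] := dominated_version (measurable_itv _) (rhs_measurable gC)
  p_measurable p_ge0 (rhs_dominated gC).
by exists h.
Qed.

Section integral_operator.
Variable G : (R -> R) -> R -> R.
Hypothesis GP : forall gamma, Cspace J gamma ->
  dominated_by p (G gamma) /\ ae_on I0 (fun t => G gamma t = rhs gamma t).

(** The minimum and maximum with [t0] merge the history condition on I_- and the
   integrated equation on I_0 into one formula. [G] selects a Borel version of
   each right-hand side. *)
Definition picard (gamma : R -> R) : R -> R := fun t =>
  if t0 - r <= t <= t0 + L then
    Lambda (truncate gamma) + k (Num.min t t0) +
      (indefinite_integral (G gamma) (Num.max t t0) - indefinite_integral (G gamma) t0)
  else 0.

Lemma picard_history gamma t : t0 - r <= t <= t0 -> picard gamma t = Lambda (truncate gamma) + k t.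
Proof.
move=> /andP[h1 h2]; rewrite /picard h1 (le_trans h2) ?lerDl ?ltW//=.
by rewrite min_l// max_r// subrr addr0.
Qed.

Lemma picard_present gamma t : t0 <= t <= t0 + L -> picard gamma t =
  Lambda (truncate gamma) + k t0 + (indefinite_integral (G gamma) t - indefinite_integral (G gamma) t0).
Proof.
move=> /andP[h1 h2]; rewrite /picard h2 andbT min_r// max_l// ifT//.
by apply: le_trans h1; rewrite gerBl.
Qed.

Lemma indefinite_integral_p_mono s t : s <= t -> indefinite_integral p s <= indefinite_integral p t.
Proof.
move=> st; rewrite -subr_ge0.
exact: le_trans (normr_ge0 _)
  (indefinite_integral_dominated p_measurable p_ge0 p_integrable (dominated_self p_measurable p_ge0) st).
Qed.

(** The history part moves with [k], uniformly in [gamma], and the increments of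
   the integral part are bounded by those of the integral of [p]. *)
Lemma picard_equicontinuous :
  equicontinuous_family (t0 - r) (t0 + L) [set picard gamma | gamma in Cspace J].
Proof.
move=> e e0; have e2 : 0 < e / 2 by lra.
have r0 := r_ge0; have [d d0 dP] := Cspace_equicontinuous k_continuous e2.
have [d' d'0 d'P] := indefinite_integral_uniform p_measurable p_ge0 p_integrable e2.
exists (Num.min d d'); first by rewrite lt_min d0.
move=> _ [g gC <-]; have [gd _] := GP gC.
suff half s t : t0 - r <= s <= t0 + L -> t0 - r <= t <= t0 + L -> s <= t ->
    t - s < Num.min d d' -> `|picard g t - picard g s| <= e.
  move=> s t sJ tJ; have [st|/ltW ts] := leP s t.
    by rewrite distrC ger0_norm ?subr_ge0// distrC; exact: half.
  by rewrite ger0_norm ?subr_ge0//; exact: half.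
move=> sJ tJ st; rewrite lt_min => /andP[std std'].
rewrite /picard sJ tJ.
have kst : `|k (Num.min t t0) - k (Num.min s t0)| <= e / 2.
  apply: dP => //.
  - by move: tJ; rewrite /Num.min; case: ltP => ? /andP[? ?]; apply/andP; split; lra.
  - by move: sJ; rewrite /Num.min; case: ltP => ? /andP[? ?]; apply/andP; split; lra.
  - rewrite ger0_norm ?subr_ge0; last by rewrite le_min !ge_min st lexx ?orbT.
    by apply: le_lt_trans std; rewrite /Num.min; do 2!case: ltP => ?; lra.
have max_st : Num.max s t0 <= Num.max t t0 by rewrite ge_max !le_max st lexx ?orbT.
have := indefinite_integral_dominated p_measurable p_ge0 p_integrable gd max_st.
have : indefinite_integral p (Num.max t t0) - indefinite_integral p (Num.max s t0) < e / 2.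
  apply: d'P => //; apply: le_lt_trans std'.
  by rewrite /Num.max; do 2!case: ltP => ?; lra.
move: kst; rewrite !ler_norml; lra.
Qed.

Lemma picard_Cspace gamma : Cspace J gamma -> Cspace J (picard gamma).
Proof.
move=> gC; apply: equicontinuous_Cspace; last first.
  by move=> t; rewrite /picard => /negP/negbTE ->.
move=> e e0; have [d d0 dP] := picard_equicontinuous e0; exists d => // _ ->.
by apply: dP; exists gamma.
Qed.

Lemma picard_bounded : exists M, forall gamma, Cspace J gamma ->
  forall t, t0 - r <= t <= t0 + L -> `|picard gamma t| <= M.
Proof.
have r0 := r_ge0; have [M kM] := Cspace_bounded k_continuous.
have t0J : t0 - r <= t0 <= t0 by rewrite gerBl r_ge0 lexx.
exists (`|alpha t0| + `|beta t0| + `|k t0| + M + (indefinite_integral p (t0 + L) - indefinite_integral p t0)).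
move=> gamma gC t tJ; rewrite /picard tJ.
have [gd _] := GP gC.
have /andP[h1 h2] := history (truncate_interval gC) t0J.
have kt : `|k (Num.min t t0)| <= M.
  apply: kM; move: tJ; rewrite /Num.min.
  by case: ltP => ? /andP[? ?]; apply/andP; split; lra.
have Lt : `|Lambda (truncate gamma)| <= `|alpha t0| + `|beta t0| + `|k t0|.
  move: h1 h2 (ler_norm (alpha t0)) (ler_norm (- alpha t0)) (ler_norm (beta t0))
    (ler_norm (- beta t0)) (ler_norm (k t0)) (ler_norm (- k t0)).
  move: (normr_ge0 (alpha t0)) (normr_ge0 (beta t0)).
  by rewrite !normrN ler_norml; lra.
have max_t : t0 <= Num.max t t0 by rewrite le_max lexx orbT.
have h3 := indefinite_integral_dominated p_measurable p_ge0 p_integrable gd max_t.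
have h4 : indefinite_integral p (Num.max t t0) <= indefinite_integral p (t0 + L).
  by apply: indefinite_integral_p_mono; rewrite ge_max; case/andP: tJ => _ ->; rewrite lerDl ltW.
apply: le_trans (ler_normD _ _) _; apply: lerD; last by apply: le_trans h3 _; rewrite lerD2r.
by apply: le_trans (ler_normD _ _) _; exact: lerD.
Qed.

Lemma picard_continuous u x : (forall n, Cspace J (u n)) -> Cspace J x -> uniformly_cvg J u x ->
  forall t, t0 - r <= t <= t0 + L -> picard (u n) t @[n --> \oo] --> picard x t.
Proof.
move=> uC xC ux t tJ; rewrite /picard tJ.
have LamP : Lambda (truncate (u n)) @[n --> \oo] --> Lambda (truncate x).
  apply: (continuous_on_Cspace_cvg Lambda_continuous) => [n||].
  - by have [] := truncate_interval (uC n).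
  - by have [] := truncate_interval xC.
  - exact: truncate_cvg.
have Gcvg : forall s, indefinite_integral (G (u n)) s @[n --> \oo] --> indefinite_integral (G x) s.
  apply: (indefinite_integral_cvg p_measurable p_ge0 p_integrable).
  - by move=> n; exact: (GP (uC n)).1.
  - exact: (GP xC).1.
  have h1 := ae_on_countable (fun n => (GP (uC n)).2).
  have h2 := rhs_cvg uC xC ux.
  have h3 := ae_on_imply2 (S := fun t => G (u n) t @[n --> \oo] --> G x t) _
    (ae_on_imply2 (S := fun t => G (u n) t @[n --> \oo] --> rhs x t) _ h1 h2) (GP xC).2.
  suff : ae_on I0 (fun t => G (u n) t @[n --> \oo] --> G x t).
    apply: negligibleS => s /= ns; apply: contra_not ns => Is _.
    have [/Is//|nI] := pselect (I0 s).
    (* Outside I_0 everything vanishes with [p]. *)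
    have G0 g : dominated_by p g -> g s = 0.
      by move=> [_ /(_ s)]; rewrite p_off// normr_le0 => /eqP.
    rewrite (G0 (G x)); last exact: (GP xC).1.
    rewrite (_ : (fun n => G (u n) s) = fun=> 0); first exact: cvg_cst.
    by apply/funext => n; apply: G0; exact: (GP (uC n)).1.
  apply: h3 => [s Is h ->//|s Is h1s h2s].
  by rewrite (_ : (fun n => G (u n) s) = (fun n => rhs (u n) s)) //; apply/funext.
apply: cvgD; first by apply: cvgD => //; exact: cvg_cst.
by apply: cvgB; exact: Gcvg.
Qed.

Lemma picard_absolutely_continuous gamma : Cspace J gamma -> absolutely_continuous_on I0 (picard gamma).
Proof.
move=> gC; apply: (dominated_increments_AC p_measurable p_ge0 p_integrable).
move=> s t /I0E sI /I0E tI st; rewrite !picard_present//.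
rewrite (_ : _ - _ = indefinite_integral (G gamma) t - indefinite_integral (G gamma) s); last by ring.
exact: indefinite_integral_dominated (GP gC).1 st.
Qed.

Lemma picard_derivable gamma : Cspace J gamma -> ae_on I0 (fun t =>
  derivable (picard gamma) t 1 /\ derive1 (picard gamma) t = rhs gamma t).
Proof.
move=> gC; have [gd gE] := GP gC.
have h1 := ae_onS (@subsetT _ I0) (indefinite_integral_derivable p_ge0 p_integrable gd).
have point c : ae_on I0 (fun t => t != c).
  exists [set c]; split => //; first exact: lebesgue_measure_set1.
  by move=> t /= nt; apply: contrapT => tc; apply: nt => _; exact/eqP.
have h2 := ae_on_imply2 (S := fun t => t != t0 /\ t != t0 + L)
  (fun _ _ => @conj _ _) (point t0) (point (t0 + L)).
have h3 := ae_on_imply2 (S := fun t => (derivable (indefinite_integral (G gamma)) t 1 /\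
    derive1 (indefinite_integral (G gamma)) t = rhs gamma t)) _ h1 gE.
apply: ae_on_imply2 h2 (h3 _) => [t /I0E/andP[t0t tL] [tt0 ttL] [dG dGE]|t _ [d1 d2] d3].
  have {}t0t : t0 < t by rewrite lt_neqAle eq_sym tt0.
  have {}tL : t < t0 + L by rewrite lt_neqAle ttL.
  pose c := Lambda (truncate gamma) + k t0 - indefinite_integral (G gamma) t0.
  have nT : \forall s \near t, (cst c \+ indefinite_integral (G gamma)) s = picard gamma s.
    have : t \in `]t0, t0 + L[ by rewrite in_itv/= t0t.
    move=> /near_in_itvoo; apply: filterS => s; rewrite in_itv/= => /andP[h h'].
    by rewrite picard_present ?(ltW h) ?(ltW h')//= /c; ring.
  have dc : derivable (cst c \+ indefinite_integral (G gamma)) t 1.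
    by apply: derivableD => //; exact: derivable_cst.
  split; first exact: near_eq_derivable nT dc.
  rewrite derive1E -(near_eq_derive _ nT)// deriveD//.
  by rewrite derive_cst add0r -derive1E.
by split => //; rewrite d2.
Qed.

(** Where x < alpha, the right-hand side is that of [alpha] with a delayed value
   in [E t], so x' >= alpha' and [barrier] applies; dually for [beta]. *)
Lemma fixed_point_interval x : Cspace J x -> picard x = x -> order_interval J alpha beta x.
Proof.
move=> xC Tx; have tr := truncate_interval xC.
have t0r : t0 - r <= t0 <= t0 by rewrite gerBl r_ge0 lexx.
have hist t : t0 - r <= t <= t0 -> alpha t <= x t <= beta t.
  by move=> tr'; rewrite -Tx picard_history//; exact: history.
have xAC : absolutely_continuous_on I0 x by rewrite -Tx; exact: picard_absolutely_continuous.
have xd : ae_on I0 (fun t => derivable x t 1 /\ derive1 x t = rhs x t).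
  by have := picard_derivable xC; rewrite Tx.
have lo : forall t, t0 <= t <= t0 + L -> alpha t <= x t.
  apply: (barrier xAC alpha_AC); first by case/andP: (hist _ t0r).
  apply: ae_on_imply2 xd alpha_lower => t It [dx dxE] [da aE]; split => // xa.
  rewrite dxE /rhs (_ : truncate x t = alpha t); last first.
    rewrite /truncate/= max_l// (le_trans _ (ltW xa))// ge_min lexx//.
  by apply: aE; exact: E_delayed.
have hi : forall t, t0 <= t <= t0 + L -> x t <= beta t.
  apply: (barrier beta_AC xAC); first by case/andP: (hist _ t0r).
  apply: ae_on_imply2 xd beta_upper => t It [dx dxE] [db bE]; split => // bx.
  rewrite dxE /rhs (_ : truncate x t = beta t); last first.
    rewrite /truncate/= min_r ?(ltW bx)// max_r// alpha_le_beta//; exact: I0J.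
  by apply: bE; exact: E_delayed.
split => // t /JE/andP[h1 h2]; have [tt0|/ltW tt0] := leP t t0.
- by have /andP[] := hist t (introT andP (conj h1 tt0)).
- by apply: lo; rewrite tt0.
- by have /andP[] := hist t (introT andP (conj h1 tt0)).
- by apply: hi; rewrite tt0.
Qed.

Let ItotalE : Itotal t0 L r = J.
Proof. exact: Itotal_itv (ltW L_gt0) r_ge0. Qed.

Lemma fixed_point_solution x : order_interval J alpha beta x -> picard x = x ->
  solution t0 L r f tau Lambda k x.
Proof.
move=> xab Tx; have [xC _ _] := xab; have xid := truncate_id xab.
rewrite /solution ItotalE; split => //.
- by rewrite -Tx; exact: picard_absolutely_continuous.
- by have := picard_derivable xC; rewrite Tx /rhs xid.
- by move=> t; rewrite /Iminus/= in_itv/= => tr; have := picard_history x tr; rewrite Tx xid.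
Qed.

(** x and [picard x] have the same derivative almost everywhere and agree at
   [t0], hence [barrier] orders them both ways. *)
Lemma solution_fixed_point x : order_interval J alpha beta x ->
  solution t0 L r f tau Lambda k x -> picard x = x.
Proof.
move=> xab [_ xAC xd xhist]; have [xC _ _] := xab; have xid := truncate_id xab.
have hist t : t0 - r <= t <= t0 -> picard x t = x t.
  by move=> tr; rewrite picard_history// xid -xhist// /Iminus/= in_itv.
have TxAC := picard_absolutely_continuous xC; have := picard_derivable xC; rewrite /rhs xid => Txd.
have t0r : t0 - r <= t0 <= t0 by rewrite gerBl r_ge0 lexx.
have le1 : forall t, t0 <= t <= t0 + L -> picard x t <= x t.
  apply: (barrier xAC TxAC); first by rewrite hist.
  by apply: ae_on_imply2 xd Txd => t _ [dx ->] [dT ->].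
have le2 : forall t, t0 <= t <= t0 + L -> x t <= picard x t.
  apply: (barrier TxAC xAC); first by rewrite hist.
  by apply: ae_on_imply2 xd Txd => t _ [dx ->] [dT ->].
apply/funext => t; have [/JE/andP[h1 h2]|nJ] := pselect (J t); last first.
  by rewrite xC.2//; exact: (picard_Cspace xC).2.
have [h|/ltW h] := leP t t0; first by rewrite hist// h1.
by apply/eqP; rewrite eq_le le1 ?le2// h.
Qed.

Lemma fixed_points_closed y : Cspace J y ->
  (forall e, 0 < e -> exists2 x, order_interval J alpha beta x /\ picard x = x &
     forall t, t0 - r <= t <= t0 + L -> `|x t - y t| <= e) ->
  order_interval J alpha beta y /\ picard y = y.
Proof.
move=> yC yapp.
have /choice[u uP] n : exists x, [/\ order_interval J alpha beta x, picard x = x &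
    forall t, t0 - r <= t <= t0 + L -> `|x t - y t| <= n.+1%:R^-1].
  by have [|x [xab Tx] xy] := yapp n.+1%:R^-1; [rewrite invr_gt0|exists x].
have ut t : t0 - r <= t <= t0 + L -> u n t @[n --> \oo] --> y t.
  move=> tJ; apply: (@cvg_harmonic_bound _ _ _ 1) => n; rewrite mul1r.
  by have [_ _ ->] := uP n.
have uC n : Cspace J (u n) by have [[]] := uP n.
have Ty : picard y = y.
  apply/funext => t; have [/JE tJ|nJ] := pselect (J t); last first.
    by rewrite yC.2//; exact: (picard_Cspace yC).2.
  apply: cvg_unique (ut t tJ) => //.
  rewrite (_ : (fun n => u n t) = (fun n => picard (u n) t)); last first.
    by apply/funext => n; have [_ ->] := uP n.
  apply: picard_continuous => // e e0; have [N NP] := harmonic_le e0.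
  exists N => n Nn s /JE sJ; apply: le_trans (NP n Nn).
  by have [_ _ ->] := uP n.
by split => //; exact: fixed_point_interval.
Qed.

Lemma exists_fixed_point : exists2 x, Cspace J x & picard x = x.
Proof.
have [M TM] := picard_bounded.
apply: (schauder_interval (M := M)) => //.
- by rewrite (@le_trans _ _ t0)// ?gerBl// lerDl ltW.
- exact: picard_Cspace.
- exact: picard_equicontinuous.
- exact: picard_continuous.
Qed.

Lemma extremal_solutions_from_version :
  (exists xmax, maximal_solution t0 L r f tau Lambda k
                  (order_interval J alpha beta) xmax) /\
  (exists xmin, minimal_solution t0 L r f tau Lambda k
                  (order_interval J alpha beta) xmin).
Proof.
pose S x := order_interval J alpha beta x /\ picard x = x.
have [M TM] := picard_bounded.
have S0 : S !=set0.
  have [x xC Tx] := exists_fixed_point.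
  by exists x; split => //; exact: fixed_point_interval.
have SC : S `<=` Cspace J by move=> x [[]].
have Se : equicontinuous_family (t0 - r) (t0 + L) S.
  move=> e e0; have [d d0 dP] := picard_equicontinuous e0; exists d => // x Sx.
  by apply: dP; exists x; [exact: SC|exact: Sx.2].
have SM x : S x -> forall t, t0 - r <= t <= t0 + L -> `|x t| <= M.
  by move=> Sx; rewrite -Sx.2; apply: TM; exact: SC.
split.
- have [x [xab Tx] xmax] := exists_maximal S0 SC Se SM fixed_points_closed.
  exists x; split => //; first exact: fixed_point_solution.
  move=> y yab ysol; rewrite ItotalE; apply: xmax.
  by split => //; exact: solution_fixed_point.
- have [x [xab Tx] xmin] := exists_minimal S0 SC Se SM fixed_points_closed.
  exists x; split => //; first exact: fixed_point_solution.
  move=> y yab ysol; rewrite ItotalE; apply: xmin.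
  by split => //; exact: solution_fixed_point.
Qed.

End integral_operator.

Lemma extremal_solutions :
  (exists xmax, maximal_solution t0 L r f tau Lambda k
                  (order_interval J alpha beta) xmax) /\
  (exists xmin, minimal_solution t0 L r f tau Lambda k
                  (order_interval J alpha beta) xmin).
Proof.
by have [G GP] := exists_rhs_version; exact: extremal_solutions_from_version GP.
Qed.

End FunctionalProblem.

(** The delayed argument of [gamma] lies between [tau_inf t] and [tau_sup t],
   where [gamma] is enclosed by [alpha] and [beta]. *)
Lemma Eset_delayed (R : realType) (t0 L r : R) (tau : R -> (R -> R) -> R)
    (alpha beta gamma : R -> R) (t : R) : 0 <= L -> 0 <= r ->
  (forall g, Cspace (Itotal t0 L r) g -> Itotal t0 L r (tau t g)) ->
  Cspace (Itotal t0 L r) alpha -> Cspace (Itotal t0 L r) beta ->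
  order_interval (Itotal t0 L r) alpha beta gamma ->
  Eset t0 L r tau alpha beta t (gamma (tau t gamma)).
Proof.
move=> L0 r0; rewrite /Eset /tau_inf /tau_sup Itotal_itv// => tauJ aC bC [gC ag gb].
set S := [set tau t g | g in _]; have Sg : S (tau t gamma) by exists gamma.
have SJ s : S s -> t0 - r <= s <= t0 + L.
  by move=> [g /tauJ + <-]; rewrite /= in_itv.
have Sl : inf S <= tau t gamma.
  by apply: ge_inf => //; exists (t0 - r) => s /SJ/andP[].
have Su : tau t gamma <= sup S.
  by apply: ub_le_sup => //; exists (t0 + L) => s /SJ/andP[].
have lS : t0 - r <= inf S.
  by apply: lb_le_inf; [exists (tau t gamma)|move=> s /SJ/andP[]].
have uS : sup S <= t0 + L.
  by apply: ge_sup; [exists (tau t gamma)|move=> s /SJ/andP[]].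
have tJ := tauJ gamma gC.
have [Ma aM] := Cspace_bounded aC; have [Mb bM] := Cspace_bounded bC.
rewrite /= in_itv/=; apply/andP; split.
- apply: le_trans (ag _ tJ); apply: ge_inf.
    exists (- Ma) => _ [s /= + <-]; rewrite in_itv/= => /andP[h1 h2].
    have : `|alpha s| <= Ma by apply: aM; rewrite (le_trans lS h1) (le_trans h2 uS).
    by rewrite ler_norml => /andP[].
  by exists (tau t gamma) => //=; rewrite in_itv/= Sl.
- apply: le_trans (gb _ tJ) _; apply: ub_le_sup.
    exists Mb => _ [s /= + <-]; rewrite in_itv/= => /andP[h1 h2].
    have : `|beta s| <= Mb by apply: bM; rewrite (le_trans lS h1) (le_trans h2 uS).
    by rewrite ler_norml => /andP[].
  by exists (tau t gamma) => //=; rewrite in_itv/= Sl.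
Qed.

(** * Extremal solutions *)

Theorem theorem2p1 (R : realType) (t0 L r : R)
  (f : R -> R -> R -> R) (tau : R -> (R -> R) -> R)
  (Lambda : (R -> R) -> R) (k alpha beta : R -> R)
  (L_gt0 : 0 < L) (r_ge0 : 0 <= r)
  (f_caratheodory : caratheodory_scalar (Itotal t0 L r) f)
  (tau_range : forall t gamma, Izero t0 L t -> Cspace (Itotal t0 L r) gamma ->
     Itotal t0 L r (tau t gamma))
  (tau_caratheodory : caratheodory_operator (Izero t0 L) (Itotal t0 L r) tau)
  (k_continuous : Cspace (Iminus t0 r) k)
  (alpha_beta : lower_upper_solutions t0 L r f tau Lambda k alpha beta)
  (f_measurable : forall x y : R,
     inf (alpha @` Itotal t0 L r) <= x <= sup (beta @` Itotal t0 L r) ->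
     inf (alpha @` Itotal t0 L r) <= y <= sup (beta @` Itotal t0 L r) ->
     Lebesgue_measurable_fun (Itotal t0 L r) (fun t => f t x y))
  (f_continuous : ae_on (Izero t0 L) (fun t => forall x y : R,
     alpha t <= x <= beta t -> Eset t0 L r tau alpha beta t y ->
     continuous (fun z => f t z y) /\ continuous (fun z => f t x z)))
  (tau_measurable : forall gamma,
     order_interval (Itotal t0 L r) alpha beta gamma ->
     Lebesgue_measurable_fun (Izero t0 L) (fun t => tau t gamma))
  (tau_continuous : ae_on (Izero t0 L) (fun t =>
     continuous_on_Cspace (Itotal t0 L r) (tau t)))
  (Lambda_continuous : continuous_on_Cspace (Itotal t0 L r) Lambda)
  (f_bounded : exists psi : R -> R, Lebesgue_integrable (Izero t0 L) psi /\
     ae_on (Izero t0 L) (fun t => forall x y : R,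
       alpha t <= x <= beta t -> Eset t0 L r tau alpha beta t y ->
       `|f t x y| <= psi t)) :
  (exists xmax, maximal_solution t0 L r f tau Lambda k
                  (order_interval (Itotal t0 L r) alpha beta) xmax) /\
  (exists xmin, minimal_solution t0 L r f tau Lambda k
                  (order_interval (Itotal t0 L r) alpha beta) xmin).

Proof.
have L0 := ltW L_gt0; have JE := @Itotal_itv R t0 L r L0 r_ge0.
have IJ : Izero t0 L `<=` Itotal t0 L r by move=> t It; right.
have mJ : measurable (Itotal t0 L r) by rewrite JE; exact: measurable_itv.
case: alpha_beta => [[aC bC ab] aAC bAC [ad ah] [bd bh]].
have [psi [psi_int psi_dom]] := f_bounded.
have [p [mp p0 [pz ip] psip]] := Borel_dominant (measurable_itv _) psi_int.
rewrite JE in aC bC ab ah bh *.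
pose E := Eset t0 L r tau alpha beta.
apply: (@extremal_solutions R t0 L r f tau Lambda k alpha beta p E) => //.
- by move=> x y; apply: (Lebesgue_measurable_funS mJ IJ); exact: f_caratheodory.1.
- exact: ae_onS IJ f_caratheodory.2.
- by move=> t g It gC; rewrite -JE; apply: tau_range => //; rewrite JE.
- by move=> g gC; apply: tau_caratheodory.1; rewrite JE.
- by rewrite -JE.
- by rewrite -JE.
- move=> g gab t; rewrite -[_ <= _ <= _]/(t \in `[t0 - r, t0]) => It.
  apply/andP; split; rewrite -lee_fin EFinD.
    apply: le_trans (ah t It) _; rewrite leeD2r//; apply: ereal_inf_lbound.
    by exists g.
  apply: le_trans (bh t It); rewrite leeD2r//; apply: ereal_sup_ubound.
  by exists g.
- move=> t g It gab; apply: Eset_delayed => //; rewrite ?JE//.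
  by move=> h hC; rewrite -JE; apply: tau_range => //; rewrite JE.
- apply: ae_on_imply ad => t It [da aE]; split => // xi Exi.
  rewrite -lee_fin; apply: le_trans aE _; apply: ereal_inf_lbound.
  by exists xi.
- apply: ae_on_imply bd => t It [db bE]; split => // xi Exi.
  rewrite -lee_fin; apply: le_trans bE; apply: ereal_sup_ubound.
  by exists xi.
- apply: ae_on_imply2 psi_dom psip => t It fpsi psit x y xab Ey.
  exact: le_trans (fpsi x y xab Ey) psit.
Qed.
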